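(* Let $\varphi$ be a $\mathcal{C}^1$ strictly convex function on $\mathbb{R}^n$ such that $\lim_{\|x\|\to\infty}\varphi(x)/\|x\|=\infty$ and $\int e^{-\varphi(x)}dx=1$. Then for all $\lambda>0$ and for every smooth enough function $g$ on $\mathbb{R}^n$ such that the integrals involved exist, $$\mathbf{Ent}_{dx}(e^g)\leq -n\log(\lambda e)\int e^g\,dx+\int\varphi^*(-\lambda\nabla g)\,e^g\,dx.$$ Moreover, this inequality is optimal in the sense that if $g(x)=-\varphi(x-\bar{x})$ with $\bar{x}\in\mathbb{R}^n$ and $\lambda=1$, then it is an equality.
   Context: $\|\cdot\|$ is the Euclidean norm on $\mathbb{R}^n$ and $dx$ is Lebesgue measure on $\mathbb{R}^n$. The Fenchel–Legendre transform of $\varphi$ is $\varphi^*(x)=\sup_{z\in\mathbb{R}^n}\{x\cdot z-\varphi(z)\}$. The entropy with respect to Lebesgue measure is $\mathbf{Ent}_{dx}(e^g)=\int e^g\log\frac{e^g}{\int e^g dx}\,dx$. In $\log(\lambda e)$, $e$ is Euler's number. *)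

(* Defs.v *)
From HB Require Import structures.
From mathcomp Require Import all_boot all_order all_algebra.
From mathcomp Require Import all_classical all_reals all_analysis.

Set Implicit Arguments.
Unset Strict Implicit.
Unset Printing Implicit Defensive.

Import Order.TTheory GRing.Theory Num.Theory.
Import numFieldNormedType.Exports.

Local Open Scope classical_set_scope.
Local Open Scope ring_scope.

Definition rV_display : measure_display.
Proof. exact: default_measure_display. Qed.

(* R^n is 'rV[R]_n with the product sigma-algebra generated by the n
   coordinates; R being second countable, these are the Borel sets. *)
Section measurable_rV.
Context {R : realType} (n : nat).

Let coord (i : 'I_n) (v : 'rV[R]_n) : measurableTypeR R := v ord0 i.

Let rV_set0 : g_sigma_preimage coord set0.
Proof. exact: sigma_algebra0. Qed.

Let rV_setC A : g_sigma_preimage coord A -> g_sigma_preimage coord (~` A).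
Proof. exact: sigma_algebraC. Qed.

Let rV_bigcup (F : _^nat) : (forall i, g_sigma_preimage coord (F i)) ->
  g_sigma_preimage coord (\bigcup_i (F i)).
Proof. exact: sigma_algebra_bigcup. Qed.

HB.instance Definition _ := @isMeasurable.Build rV_display 'rV[R]_n
  (g_sigma_preimage coord) rV_set0 rV_setC rV_bigcup.

Lemma measurable_fun_rVP d (T : measurableType d) (f : T -> 'rV[R]_n) :
  measurable_fun [set: T] f <->
  forall i, measurable_fun [set: T] (fun x => f x ord0 i : measurableTypeR R).
Proof.
apply: (@iff_trans _ (g_sigma_preimage (fun i => coord i \o f) `<=` measurable)).
  rewrite g_sigma_preimage_comp; split=> [mf A [/= C preC <-]|prefS].
    exact: mf.
  by move=> _ A mA; apply: prefS; exists A.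
split=> [fS i|mf].
- move=> _ A mA; apply: fS; apply: sub_sigma_algebra.
  rewrite -bigcup_seq/=; exists i => /=; first by rewrite mem_index_enum.
  by exists A.
- apply: smallest_sub; first exact: sigma_algebra_measurable.
  rewrite -bigcup_seq; apply: bigcup_sub => i _.
  by move=> A [B mB <-]; exact: mf.
Qed.

Lemma measurable_rV_coord (i : 'I_n) :
  measurable_fun [set: 'rV[R]_n] (fun v => v ord0 i : measurableTypeR R).
Proof. exact: (iffLR (measurable_fun_rVP idfun) (@measurable_id _ _ setT)). Qed.

End measurable_rV.

(* Lebesgue measure on R^n, by recursion on n: on R^0 it is the unit mass at the
   only point, and on R^(n+1) it is the image of the product of the Lebesgue
   measures of R and R^n under (x, v) |-> (x, v_0, ..., v_(n-1)). *)
Section lebesgue_rV.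
Context {R : realType}.

Definition rV_cons n (p : measurableTypeR R * 'rV[R]_n) : 'rV[R]_n.+1 :=
  row_mx (p.1)%:M p.2.

Lemma rV_cons0 n p : @rV_cons n p ord0 ord0 = p.1.
Proof.
have -> : ord0 = lshift n (ord0 : 'I_1) :> 'I_(1 + n) by exact/val_inj.
by rewrite /rV_cons (@row_mxEl _ 1 1 n) mxE eqxx mulr1n.
Qed.

Lemma rV_consS n p (j : 'I_n) : @rV_cons n p ord0 (lift ord0 j) = p.2 ord0 j.
Proof.
have -> : lift ord0 j = rshift 1 j :> 'I_(1 + n) by exact/val_inj.
by rewrite /rV_cons (@row_mxEr _ 1 1 n).
Qed.

Lemma measurable_rV_cons n : measurable_fun [set: _] (@rV_cons n).
Proof.
apply/measurable_fun_rVP => i.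
case: (unliftP ord0 i) => [j|] ->; last first.
  rewrite (_ : (fun _ => _) = fst) => [|]; first exact: measurable_fst.
  by apply/funext => p; exact: rV_cons0.
under eq_fun do rewrite rV_consS.
exact: measurableT_comp (measurable_rV_coord j) measurable_snd.
Qed.

Definition rV_uncons n (v : 'rV[R]_n.+1) : measurableTypeR R * 'rV[R]_n :=
  (v ord0 ord0, \row_j v ord0 (lift ord0 j)).

Lemma rV_consK n : cancel (@rV_cons n) (@rV_uncons n).
Proof.
move=> [x v]; rewrite /rV_uncons rV_cons0; congr pair.
by apply/rowP => j; rewrite mxE rV_consS.
Qed.

Lemma measurable_rV_uncons n : measurable_fun [set: _] (@rV_uncons n).
Proof.
apply/measurable_fun_pairP; split; first exact: measurable_rV_coord.
apply/measurable_fun_rVP => j.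
under eq_fun do rewrite /= mxE.
exact: measurable_rV_coord.
Qed.

Section step.
Context (n : nat) (mu : {sigma_finite_measure set 'rV[R]_n -> \bar R}).

Definition lebesgue_rV_step : set 'rV[R]_n.+1 -> \bar R :=
  pushforward (lebesgue_measure \x mu)%E (@rV_cons n).

Let step0 : lebesgue_rV_step set0 = 0%E.
Proof. by rewrite /lebesgue_rV_step /pushforward preimage_set0 measure0. Qed.

Let step_ge0 A : (0 <= lebesgue_rV_step A)%E.
Proof. by rewrite /lebesgue_rV_step /pushforward; apply: measure_ge0. Qed.

Let step_sigma_additive : semi_sigma_additive lebesgue_rV_step.
Proof.
move=> F mF tF mUF; rewrite /lebesgue_rV_step /pushforward preimage_bigcup.
apply: measure_semi_sigma_additive.
- by move=> k; rewrite -[X in measurable X]setTI; exact: measurable_rV_cons.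
- apply/trivIsetP => /= i j _ _ ij; rewrite -preimage_setI.
  by move/trivIsetP : tF => /(_ _ _ _ _ ij) ->//; rewrite preimage_set0.
- by rewrite -preimage_bigcup -[X in measurable X]setTI; exact: measurable_rV_cons.
Qed.

HB.instance Definition _ := isMeasure.Build _ _ _ lebesgue_rV_step
  step0 step_ge0 step_sigma_additive.

Let step_sigma_finite : sigma_finite setT lebesgue_rV_step.
Proof.
have /sigma_finiteP[F [TF ndF Foo]] := sigma_finiteT (@lebesgue_measure R).
have /sigma_finiteP[G [TG ndG Goo]] := sigma_finiteT mu.
exists (fun k => @rV_uncons n @^-1` (F k `*` G k)) => [|k].
  rewrite -preimage_bigcup (_ : \bigcup_i _ = setT) ?preimage_setT//.
  rewrite -setXTT TF TG predeqE => -[x y]; split.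
    by move=> [k _ []/= ? ?]; split; exists k.
  move=> [/= [k _ Fkx] [l _ Gly]]; exists (maxn k l) => //; split.
  - by move: x Fkx; exact/subsetPset/ndF/leq_maxl.
  - by move: y Gly; exact/subsetPset/ndG/leq_maxr.
have [mF Fk] := Foo k; have [mG Gk] := Goo k.
split.
  rewrite -[X in measurable X]setTI.
  by apply: measurable_rV_uncons => //; exact: measurableX.
rewrite /lebesgue_rV_step /pushforward -comp_preimage.
rewrite (_ : _ \o _ = id) ?preimage_id; last exact/funext/rV_consK.
by rewrite product_measure1E// lte_mul_pinfty// ge0_fin_numE.
Qed.

HB.instance Definition _ := Measure_isSigmaFinite.Build _ _ _ lebesgue_rV_step
  step_sigma_finite.

End step.

Fixpoint lebesgue_rV (n : nat) : {sigma_finite_measure set 'rV[R]_n -> \bar R} :=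
  match n with
  | 0 => \d_(0 : 'rV[R]_0)
  | n'.+1 => lebesgue_rV_step (lebesgue_rV n')
  end.

Lemma lebesgue_rV_box n (A : 'I_n -> set (measurableTypeR R)) :
  (forall i, measurable (A i)) ->
  lebesgue_rV n [set v | forall i, A i (v ord0 i)] =
  (\prod_(i < n) lebesgue_measure (A i))%E.
Proof.
elim: n A => [|n IHn] A mA.
  by rewrite big_ord0 /= diracE mem_set// => -[].
rewrite big_ord_recl -IHn => [|j]; last exact: mA.
pose B := [set v : 'rV[R]_n | forall j, A (lift ord0 j) (v ord0 j)].
have mB : measurable B.
  rewrite (_ : B = \bigcap_(j in [set: 'I_n])
      ((fun v : 'rV[R]_n => v ord0 j) @^-1` A (lift ord0 j))).
    apply: fin_bigcap_measurable => // j _; rewrite -[X in measurable X]setTI.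
    exact: measurable_rV_coord.
  by apply/seteqP; split=> v /= Av j; [move=> _|]; exact: Av.
rewrite /= /lebesgue_rV_step /pushforward -product_measure1E//.
congr ((_ \x _)%E _); apply/seteqP; split=> -[x v]/=.
- move=> Av; split=> [|j].
    by have := Av ord0; rewrite rV_cons0.
  by have := Av (lift ord0 j); rewrite rV_consS.
- by move=> [Ax Av] i; case: (unliftP ord0 i) => [j|] ->;
    rewrite ?rV_consS ?rV_cons0//; exact: Av.
Qed.

End lebesgue_rV.

Section euclidean.
Context {R : realType} {n : nat}.
Implicit Types (f g phi : 'rV[R]_n -> R) (x y z : 'rV[R]_n).

Definition dotrv x z : R := \sum_i x ord0 i * z ord0 i.

(* `|x| on 'rV[R]_n is the sup norm, hence this Euclidean norm. *)
Definition enorm x : R := Num.sqrt (dotrv x x).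

Definition enorm_infty : set_system 'rV[R]_n :=
  filter_from [set: R] (fun r => [set x | r < enorm x]).

Definition superlinear phi := phi x / enorm x @[x --> enorm_infty] --> +oo.

Definition strictly_convex phi := forall x y (t : R),
  x != y -> 0 < t < 1 ->
  phi (t *: x + (1 - t) *: y) < t * phi x + (1 - t) * phi y.

Definition grad f x : 'rV[R]_n := \row_i 'D_(delta_mx ord0 i) f x.

Definition C1 f := (forall x, differentiable f x) /\ continuous (grad f).

Definition fenchel phi x : \bar R :=
  ereal_sup (range (fun z => (dotrv x z - phi z)%:E)).

Definition ent_integrand f x : R :=
  f x * ln (f x / fine (\int[lebesgue_rV n]_y (f y)%:E)%E).

Definition ent f : \bar R := (\int[lebesgue_rV n]_x (ent_integrand f x)%:E)%E.

Definition fenchel_integrand phi (lambda : R) g x : \bar R :=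
  (fenchel phi (- lambda *: grad g x) * (expR (g x))%:E)%E.

Definition integrals_exist phi (lambda : R) g :=
  [/\ (lebesgue_rV n).-integrable setT (fun x => (expR (g x))%:E),
      (lebesgue_rV n).-integrable setT (EFin \o ent_integrand (expR \o g)) &
      (lebesgue_rV n).-integrable setT (fenchel_integrand phi lambda g)].

End euclidean.

(* Main.v *)
Require Import Defs.
From mathcomp Require Import all_boot all_order all_algebra.
From mathcomp Require Import all_classical all_reals all_analysis.
From mathcomp Require Import measurable_realfun ring lra.

Set Implicit Arguments.
Unset Strict Implicit.
Unset Printing Implicit Defensive.

Import Order.TTheory GRing.Theory Num.Theory.
Import numFieldNormedType.Exports.

Local Open Scope classical_set_scope.
Local Open Scope ring_scope.

(** The inequality is the Prekopa-Leindler inequality differentiated at t = 0.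
    Let s = lambda t / (1 - t). If h (x + s y) >= e^((1-t) g(x) - t phi(y)) for
    all x and y, then Prekopa-Leindler bounds the integral of h from below by
      (lambda^t / (1-t))^n (int e^g)^(1-t) (int e^-phi)^t.
    Write w = x + s y. To first order in t, the exponent is
      g(w) - t g(w) + t (- lambda grad g(w) . y - phi(y)),
    and the last bracket is at most phi^*(- lambda grad g(w)). Hence
      h = exp (g + t (phi^*(- lambda grad g) - g + o(1)))
    is admissible, and the comparison of the terms of order t in both members
    is the claim. The constant n log (lambda e) is the logarithmic derivative of
    (lambda^t / (1-t))^n.

    Nothing is known on the growth of g, so the error o(1) is uniform only on
    bounded sets ([uniform_taylor]), and e^g and e^-phi are first restricted to
    the boxes [-M, M]^n and [-r, r]^n. Then h lives on the slightly larger box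
    [-(M + s r), M + s r]^n, and the mass of e^g in the difference of the two
    boxes has to be small compared with t. For s = lambda / k this shell can be
    chosen among k consecutive ones whose masses add up to at most the tail of
    e^g outside the first box; the lightest of them has a mass of at most the
    tail divided by k, which is what is needed ([entropy_step]). Letting t go to
    0 and then M and r to infinity gives [entropy_inequality].

    The Prekopa-Leindler inequality itself ([prekopa_leindler]) is proved by
    induction on the dimension with Tonelli's theorem. On the line it is the
    integrated form of |A + s B| >= |A| + s |B| for superlevel sets, followed by
    the inequality between arithmetic and geometric means.

    For g = - phi, convexity gives phi^*(grad phi(x)) = x . grad phi(x) - phi(x),
    and equality amounts to int (x . grad phi) e^-phi = n. That this integral is
    at least n is the inequality just proved applied to - phi. That it is finite
    and at most n ([radial_integral_le]) follows from Fatou's lemma, because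
    int e^(-phi(r x)) dx = r^-n and the difference quotients of this identity at
    r = 1 bound those of phi, weighted by e^-phi, which converge to x . grad phi(x). *)

(** * Affine changes of variables and iterated integration *)

Section affine_line.
Context {R : realType}.
Local Open Scope ereal_scope.
Local Notation mu := (@lebesgue_measure R).

Lemma measurable_affine (a c : R) :
  measurable_fun [set: measurableTypeR R] (fun x => (a * x + c)%R : measurableTypeR R).
Proof. by apply: measurable_funD => //; exact: measurable_funM. Qed.

(** Both members are measures, up to the factor a, that agree on half-open
    intervals. *)
Lemma lebesgue_measure_affine (a c : R) (A : set R) : (0 < a)%R -> measurable A ->
  mu ((fun x => (a * x + c)%R) @^-1` A) = (a^-1)%:E * mu A.
Proof.
move=> a0 mA.
have a0' : (0 <= a)%R by exact: ltW.
have mphi := measurable_affine a c.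
pose phi := fun x : measurableTypeR R => (a * x + c)%R : measurableTypeR R.
suff /(_ mphi A mA) -> : forall A, measurable A ->
    mu A = mscale (NngNum a0') (pushforward mu phi) A.
  by rewrite /mscale/= /pushforward muleA -EFinM mulVf ?gt_eqF// mul1e.
move=> {}mphi {mA}A mA; apply: (lebesgue_measure_unique _ mA) => //= _ [[x y]] _ <-.
rewrite /mscale/= [X in _ = _ * X]/pushforward.
have -> : phi @^-1` [set x0 | x0 \in `]x, y]] =
    `]((x - c) / a)%R, ((y - c) / a)%R]%classic :> set R.
  apply/seteqP; split => z /=; rewrite !in_itv/= ltr_pdivrMr// ler_pdivlMr//;
    rewrite ltrBlDr lerBrDr mulrC//.
rewrite !lebesgue_measure_itv/= !lte_fin ltr_pM2r ?invr_gt0// ltrD2r.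
case: ifPn => _; last by rewrite mule0.
rewrite -!EFinB -EFinM; congr (_%:E).
by field; rewrite gt_eqF.
Qed.

Lemma ge0_integral_affine (a c : R) (f : R -> \bar R) : (0 < a)%R ->
  measurable_fun [set: measurableTypeR R] f -> (forall x, 0 <= f x) ->
  \int[mu]_x f (a * x + c)%R = (a^-1)%:E * \int[mu]_x f x.
Proof.
move=> a0 mf f0.
have a0' : (0 <= a^-1)%R by rewrite invr_ge0 ltW.
have mphi := measurable_affine a c.
pose phi := fun x : measurableTypeR R => (a * x + c)%R : measurableTypeR R.
rewrite -[LHS]/(\int[mu]_(x in phi @^-1` setT) (f \o phi) x).
rewrite -(ge0_integral_pushforward mphi)//.
rewrite -(ge0_integral_mscale mu measurableT (NngNum a0'))//.
apply: eq_measure_integral => //= A mA _.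
by rewrite /= /mscale/= -(lebesgue_measure_affine c).
Qed.

End affine_line.

Section rV_integral.
Context {R : realType}.
Local Open Scope ereal_scope.
Local Notation mu := (@lebesgue_measure R).
Local Notation L := (@lebesgue_rV R).

Lemma measurable_rV_section n d (T : measurableType d) (f : 'rV[R]_n.+1 -> T) (s : R) :
  measurable_fun setT f -> measurable_fun setT (fun v : 'rV[R]_n => f (rV_cons (s, v))).
Proof.
move=> mf; apply: (measurableT_comp mf).
by apply: (measurableT_comp (@measurable_rV_cons R n)); exact: measurable_pair1.
Qed.

Lemma measurable_rV_marginal n (f : 'rV[R]_n.+1 -> \bar R) :
  measurable_fun setT f -> (forall x, 0 <= f x) ->
  measurable_fun [set: measurableTypeR R] (fun s => \int[L n]_v f (rV_cons (s, v))).
Proof.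
move=> mf f0.
apply: (@measurable_fun_fubini_tonelli_F _ _ _ _ _ (L n)
  (fun p : measurableTypeR R * 'rV[R]_n => f (rV_cons p))).
- exact: measurableT_comp mf (@measurable_rV_cons R n).
- by move=> p; exact: (f0 (rV_cons p)).
Qed.

Lemma integral_rV_cons n (f : 'rV[R]_n.+1 -> \bar R) :
  measurable_fun setT f -> (forall x, 0 <= f x) ->
  \int[L n.+1]_x f x = \int[mu]_s \int[L n]_v f (rV_cons (s, v)).
Proof.
move=> mf f0.
rewrite /= /lebesgue_rV_step (ge0_integral_pushforward (@measurable_rV_cons R n))//.
rewrite preimage_setT fubini_tonelli1//.
  exact: measurableT_comp mf (@measurable_rV_cons R n).
by move=> p; exact: (f0 (rV_cons p)).
Qed.

Lemma integral_rV0 (f : 'rV[R]_0 -> \bar R) :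
  \int[L 0]_x f x = f 0%R.
Proof.
rewrite /= integral_dirac//=.
  by rewrite diracE in_setT mul1e.
move=> _ Y mY; rewrite setTI.
case: (pselect (Y (f 0%R))) => h.
  suff -> : f @^-1` Y = setT by exact: measurableT.
  by apply/seteqP; split => // x _ /=; rewrite thinmx0.
suff -> : f @^-1` Y = set0 by exact: measurable0.
by apply/seteqP; split => // x /=; rewrite thinmx0.
Qed.

Lemma measurable_rV_affine n (a : R) (c : 'rV[R]_n) :
  measurable_fun [set: 'rV[R]_n] (fun x => (a *: x + c)%R).
Proof.
apply/measurable_fun_rVP => i.
rewrite (_ : (fun x => _) =
    (fun x : R => (a * x + c ord0 i)%R) \o (fun v : 'rV[R]_n => v ord0 i)).
  apply: (measurableT_comp (measurable_affine _ _)).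
  exact: measurable_rV_coord.
by apply/funext => x; rewrite /= !mxE.
Qed.

Lemma rV_cons_affine n (a s r : R) (u v : 'rV[R]_n) :
  (a *: rV_cons (s, u) + rV_cons (r, v) = rV_cons ((a * s + r)%R, a *: u + v))%R.
Proof.
have E m (x y : 'rV[R]_m) i : (a *: x + y)%R ord0 i = (a * x ord0 i + y ord0 i)%R.
  by rewrite !mxE.
apply/rowP => i; rewrite E.
by case: (unliftP ord0 i) => [j|] ->; rewrite ?rV_consS ?rV_cons0//= E.
Qed.

Lemma rV_consP n (c : 'rV[R]_n.+1) : exists r v, c = rV_cons (r, v).
Proof.
exists (c ord0 ord0), (\row_j c ord0 (lift ord0 j))%R; apply/rowP => i.
by case: (unliftP ord0 i) => [j|] ->; rewrite ?rV_consS ?rV_cons0//= mxE.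
Qed.

(** Induction on the dimension: after Tonelli's theorem, the inner integral is
    the case of dimension n and the outer one is an affine substitution on the
    line; each contributes its factor 1/a. *)
Lemma ge0_integral_rV_affine n (a : R) (c : 'rV[R]_n) (f : 'rV[R]_n -> \bar R) :
  (0 < a)%R -> measurable_fun setT f -> (forall x, 0 <= f x) ->
  \int[L n]_x f (a *: x + c)%R = (a^-1 ^+ n)%:E * \int[L n]_x f x.
Proof.
move=> a0; elim: n c f => [|n IHn] c f mf f0.
  rewrite !integral_rV0 expr0 mul1e; congr f; apply/rowP => -[]//.
have [r [v cE]] := rV_consP c.
have mfa : measurable_fun setT (fun x : 'rV[R]_n.+1 => f (a *: x + c)%R).
  exact: measurableT_comp mf (measurable_rV_affine _ _).
rewrite integral_rV_cons// integral_rV_cons//.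
pose F s := \int[L n]_x f (rV_cons (s, x)).
have mF : measurable_fun [set: measurableTypeR R] F by exact: measurable_rV_marginal.
have F0 s : 0 <= F s by apply: integral_ge0.
have k0 : 0 <= (a^-1 ^+ n)%:E by rewrite lee_fin exprn_ge0// invr_ge0 ltW.
transitivity (\int[mu]_s ((a^-1 ^+ n)%:E * F (a * s + r)%R)).
  apply: eq_integral => s _; rewrite cE.
  under eq_integral do rewrite rV_cons_affine.
  rewrite (IHn v (fun x => f (rV_cons ((a * s + r)%R, x))))//.
  exact: measurable_rV_section.
have mFa : measurable_fun [set: measurableTypeR R] (fun s => F (a * s + r)%R).
  exact: measurableT_comp mF (measurable_affine _ _).
have Fa0 (s : measurableTypeR R) : setT s -> 0 <= F (a * s + r)%R by move=> _; exact: F0.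
rewrite (ge0_integralZl mu measurableT mFa Fa0 k0).
rewrite (ge0_integral_affine r a0 mF F0).
by rewrite muleA -EFinM exprSr.
Qed.

End rV_integral.

(** * Brunn-Minkowski inequality and layer cake formula on the line *)

Lemma measurable_set_bool d (T : measurableType d) (P : T -> bool) :
  measurable_fun setT P -> measurable [set x | P x].
Proof.
move=> /(_ measurableT [set true]); rewrite setTI; apply.
by [].
Qed.

Section brunn_minkowski_line.
Context {R : realType}.
Local Open Scope ereal_scope.
Local Notation mu := (@lebesgue_measure R).

(** With a = max A and b = min B, the translates A + s b and a + s B are both
    contained in C and meet only at the point a + s b: the first lies to its
    left and the second to its right. *)
Lemma brunn_minkowski_compact (A B C : set R) (s : R) : (0 < s)%R ->
  compact A -> compact B -> measurable C -> A !=set0 -> B !=set0 ->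
  (forall x y, A x -> B y -> C (x + s * y)%R) ->
  mu A + s%:E * mu B <= mu C.
Proof.
move=> s0 cA cB mC A0 B0 ABC.
have mA := compact_measurable cA; have mB := compact_measurable cB.
have idc (D : set R) : {within D, continuous (idfun : R -> R)}.
  by apply: continuous_subspaceT => x; exact: cvg_id.
have [a Aa maxa] : exists2 a, A a & forall t, A t -> (t <= a)%R.
  have [a /set_mem Aa h] := compact_EVT_max A0 cA (idc A).
  by exists a => // t At; apply: h; exact: mem_set.
have [b Bb minb] : exists2 b, B b & forall t, B t -> (b <= t)%R.
  have [b /set_mem Bb h] := compact_EVT_min B0 cB (idc B).
  by exists b => // t Bt; apply: h; exact: mem_set.
pose p := (a + s * b)%R.
pose X1 := (fun x => (1 * x + - (s * b))%R) @^-1` A.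
pose X2 := (fun x => (s^-1 * x + - (s^-1 * a))%R) @^-1` B.
have mX1 : measurable X1.
  by rewrite -[X1]setTI; exact: measurable_affine.
have mX2 : measurable X2.
  by rewrite -[X2]setTI; exact: measurable_affine.
have -> : mu A = mu X1.
  by rewrite /X1 lebesgue_measure_affine// invr1 mul1e.
have -> : s%:E * mu B = mu X2.
  by rewrite /X2 lebesgue_measure_affine ?invr_gt0// invrK.
have mC1 : measurable (C `&` `]-oo, p[%classic) by apply: measurableI.
have mC2 : measurable (C `&` `[p, +oo[%classic) by apply: measurableI.
have -> : C = (C `&` `]-oo, p[%classic) `|` (C `&` `[p, +oo[%classic).
  rewrite -setIUr; apply/seteqP; split => [x Cx|x []//]; split => //.
  by rewrite /= !in_itv/= andbT; case: (ltP x p); [left|right].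
rewrite measureU//; last first.
  apply/seteqP; split => // x [[_ xp] [_ px]].
  by move: xp px; rewrite /= !in_itv/= andbT => xp; rewrite leNgt xp.
apply: leeD.
- apply: (@le_trans _ _ (mu ((C `&` `]-oo, p[%classic) `|` [set p]))).
    apply: le_measure; rewrite ?inE//.
      exact: measurableU.
    move=> x; rewrite /X1/= mul1r => Ax.
    have := maxa _ Ax; rewrite lerBlDr le_eqVlt => /orP[/eqP ->|xp]; first by right.
    left; split; last by rewrite /= in_itv.
    by have := ABC _ _ Ax Bb; rewrite subrK.
  apply: (le_trans (measureU2 _ _ _)) => //.
  rewrite [X in _ + X](_ : _ = 0) ?adde0//.
  exact: lebesgue_measure_set1.
- apply: le_measure; rewrite ?inE//.
  move=> x; rewrite /X2/= => Bx.
  have s1 : (s != 0)%R by rewrite gt_eqF.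
  have E : x = (a + s * (s^-1 * x - s^-1 * a))%R by field.
  split; first by rewrite E; exact: ABC.
  by rewrite /= in_itv/= andbT E /p lerD2l ler_pM2l// minb.
Qed.

(** Inner regularity reduces the claim to compact subsets of A and B; adding a
    point to them keeps them nonempty. *)
Lemma brunn_minkowski_line (A B C : set R) (s : R) : (0 < s)%R ->
  measurable A -> measurable B -> measurable C ->
  mu A < +oo -> mu B < +oo -> A !=set0 -> B !=set0 ->
  (forall x y, A x -> B y -> C (x + s * y)%R) ->
  mu A + s%:E * mu B <= mu C.
Proof.
move=> s0 mA mB mC Aoo Boo [a Aa] [b Bb] ABC.
have inner (D : set R) (d e : R) : measurable D -> mu D < +oo -> D d -> (0 < e)%R ->
    exists K, [/\ compact K, K `<=` D, K d & mu D <= mu K + e%:E].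
  move=> mD Doo Dd e0.
  have [V [cV VD DVe]] := lebesgue_regularity_inner mD Doo e0.
  have mV := compact_measurable cV.
  exists (V `|` [set d]); split.
  - by apply: compactU => //; exact: compact_set1.
  - by move=> x [/VD//|->].
  - by right.
  - rewrite -{1}(setDKU VD) setUC.
    apply: (le_trans (measureU2 _ _ _)) => //; first exact: measurableD.
    apply: leeD; last exact: ltW.
    by apply: le_measure; rewrite ?inE//; apply: measurableU.
apply/lee_addgt0Pr => e e0.
have e1 : (0 < e / (1 + s))%R by rewrite divr_gt0// addr_gt0.
have [K1 [cK1 K1A K1a AK]] := inner _ _ _ mA Aoo Aa e1.
have [K2 [cK2 K2B K2b BK]] := inner _ _ _ mB Boo Bb e1.
have s0' : 0 <= s%:E by rewrite lee_fin ltW.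
apply: (@le_trans _ _ ((mu K1 + (e / (1 + s))%:E) + s%:E * (mu K2 + (e / (1 + s))%:E))).
  by apply: leeD => //; exact: lee_wpmul2l.
have -> : e%:E = (e / (1 + s))%:E + s%:E * (e / (1 + s))%:E.
  rewrite -EFinM -EFinD; congr (_%:E); field.
  by rewrite gt_eqF// addr_gt0.
rewrite ge0_muleDr ?lee_fin ?(ltW e1)//.
rewrite addeACA leeD2r//.
apply: brunn_minkowski_compact => //; [by exists a|by exists b|].
by move=> x y Kx Ky; apply: ABC; [exact: K1A|exact: K2B].
Qed.

(** Tonelli's theorem for the indicator function of the region between the graph
    of f and the axis. *)
Lemma layer_cake (f : R -> R) : measurable_fun [set: measurableTypeR R] f ->
  (forall x, 0 <= f x)%R ->
  \int[mu]_x (f x)%:E = \int[mu]_(r in `[0%R, +oo[) mu [set x | (r < f x)%R].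
Proof.
move=> mf f0.
pose S := [set p : measurableTypeR R * measurableTypeR R | (0 <= p.2)%R && (p.2 < f p.1)%R].
have mS : measurable S.
  have m2 : measurable_fun [set: measurableTypeR R * measurableTypeR R]
      (fun p : measurableTypeR R * measurableTypeR R => p.2 : R) by exact: measurable_snd.
  have m1 : measurable_fun [set: measurableTypeR R * measurableTypeR R]
      (fun p : measurableTypeR R * measurableTypeR R => f p.1).
    exact: measurableT_comp mf measurable_fst.
  apply: measurable_set_bool; apply: measurable_and.
    exact: (measurable_fun_ler (measurable_cst (0 : R)%R) m2).
  exact: (measurable_fun_ltr m2 m1).
pose F p := (\1_S p : R)%:E.
have mI : measurable_fun setT (\1_S : measurableTypeR R * measurableTypeR R -> R).
  exact: measurable_indic.
have mF : measurable_fun [set: measurableTypeR R * measurableTypeR R] F.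
  by apply: measurableT_comp mI; exact: EFin_measurable.
have F0 p : 0 <= F p by rewrite lee_fin.
have := @fubini_tonelli _ _ _ _ R mu mu F mF F0.
have -> : \int[mu]_x \int[mu]_y F (x, y) = \int[mu]_x (f x)%:E.
  apply: eq_integral => x _.
  transitivity (\int[mu]_y (\1_(`[0%R, f x[%classic) y)%:E).
    apply: eq_integral => y _; rewrite /F !indicE.
    suff -> : ((x, y) \in S) = (y \in `[0%R, f x[%classic) by [].
    by apply/idP/idP; rewrite !inE/= ?in_itv.
  rewrite integral_indic// setIT /= lebesgue_measure_itv/= lte_fin.
  case: ltP => h; first by rewrite -EFinB subr0.
  by congr (_%:E); apply/eqP; rewrite eq_le f0 h.
move=> ->.
rewrite [RHS]integral_mkcond; apply: eq_integral => y _.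
rewrite patchE; case: ifPn; rewrite ?notin_setE ?inE/= in_itv/= andbT => y0.
  transitivity (\int[mu]_x (\1_[set x | (y < f x)%R] x)%:E).
    apply: eq_integral => x _; rewrite /F !indicE.
    suff -> : ((x, y) \in S) = (x \in [set x | (y < f x)%R]) by [].
    by apply/idP/idP; rewrite !inE /S /= y0.
  rewrite integral_indic// ?setIT//.
  apply: measurable_set_bool.
  exact: (measurable_fun_ltr (measurable_cst (y : R)) mf).
apply: integral0_eq => x _; rewrite /F indicE memNset//=.
by case/andP => h; rewrite h in y0.
Qed.

End brunn_minkowski_line.

(** * Prekopa-Leindler inequality on the line *)

Section prekopa_leindler_line.
Context {R : realType}.
Local Notation mu := (@lebesgue_measure R).

Lemma expR_convex (t x y : R) : 0 <= t <= 1 ->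
  expR ((1 - t) * x + t * y) <= (1 - t) * expR x + t * expR y.
Proof.
case/andP => t0 t1; set m := _ + _.
have admissible z : expR m * (1 + (z - m)) <= expR z.
  have -> : expR z = expR m * expR (z - m) by rewrite -expRD subrKC.
  by rewrite ler_pM2l ?expR_gt0// expR_ge1Dx.
have h1 : 0 <= 1 - t by rewrite subr_ge0.
apply: le_trans (lerD (ler_wpM2l h1 (admissible x)) (ler_wpM2l t0 (admissible y))).
rewrite le_eqVlt; apply/orP; left; apply/eqP.
by rewrite /m; ring.
Qed.

Lemma powR_am_gm (t x y : R) : 0 < t < 1 -> 0 < x -> 0 < y ->
  x `^ (1 - t) * y `^ t <= (1 - t) * x + t * y.
Proof.
case/andP => t0 t1 x0 y0.
rewrite /powR !gt_eqF// -expRD -{2}(lnK x0) -{2}(lnK y0).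
by apply: expR_convex; rewrite !ltW.
Qed.

(** The measure of the superlevel sets is the measure of the horizontal sections
    of the region below the graph. *)
Lemma measurable_superlevel (f : R -> R) : measurable_fun [set: measurableTypeR R] f ->
  measurable_fun [set: measurableTypeR R] (fun r => mu [set x | r < f x]).
Proof.
move=> mf.
pose S := [set p : measurableTypeR R * measurableTypeR R | p.2 < f p.1].
have mS : measurable S.
  have m2 : measurable_fun [set: measurableTypeR R * measurableTypeR R]
      (fun p : measurableTypeR R * measurableTypeR R => p.2 : R) by exact: measurable_snd.
  have m1 : measurable_fun [set: measurableTypeR R * measurableTypeR R]
      (fun p : measurableTypeR R * measurableTypeR R => f p.1).
    exact: measurableT_comp mf measurable_fst.
  by apply: measurable_set_bool; exact: (measurable_fun_ltr m2 m1).
rewrite (_ : (fun r => _) = (fun r => mu (ysection S r))).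
  exact: measurable_fun_ysection.
by apply/funext => r; congr (mu _); apply/seteqP; split => x; rewrite /ysection/= inE.
Qed.

(** Bounded with bounded support: all integrals are finite, and this class is
    stable under the marginals used in the induction on the dimension. *)
Definition line_bump (C K : R) (u : R -> R) :=
  measurable_fun [set: measurableTypeR R] u /\
  forall x, 0 <= u x <= C * \1_(`[- K, K]%classic) x.

Lemma line_bump_ge0 C K u x : line_bump C K u -> 0 <= u x.
Proof. by case=> _ /(_ x)/andP[]. Qed.

Lemma line_bump_superlevel_lty C K u r : line_bump C K u -> 0 <= r ->
  (mu [set x | (r < u x)%R] < +oo)%E.
Proof.
move=> [mu_ ub] r0; apply: (@le_lt_trans _ _ (mu `[- K, K]%classic)).
  apply: le_measure; rewrite ?inE//.
    apply: measurable_set_bool; exact: (measurable_fun_ltr (measurable_cst (r : R)) mu_).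
  move=> x /= rux; have /andP[_] := ub x; rewrite indicE.
  case: (boolP (x \in `[- K, K]%classic)) => [/set_mem//|_].
  by rewrite mulr0 => ux; have := lt_le_trans rux ux; rewrite ltNge r0.
by rewrite /= lebesgue_measure_itv/=; case: ifPn => // _; rewrite -EFinB ltry.
Qed.

(** Dividing a nonzero u by its supremum makes all its superlevel sets below 1
    nonempty, as the Brunn-Minkowski inequality requires. *)
Lemma line_bump_supP C K u : line_bump C K u -> u = cst 0 \/
  [/\ 0 < sup (range u), forall x, u x <= sup (range u) &
    forall r, r < 1 -> exists x, r < u x / sup (range u)].
Proof.
move=> bu; have [mu_ ub] := bu.
have ubC x : u x <= `|C|.
  have /andP[_ /le_trans] := ub x; apply; rewrite indicE.
  by case: (_ \in _); rewrite ?mulr1 ?mulr0// ler_norm.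
have hs : has_sup (range u).
  split; first by exists (u 0), 0.
  by exists `|C| => _ [x _ <-].
have le_sup x : u x <= sup (range u).
  by apply: ub_le_sup; [exact: hs.2|exists x].
have s0 : 0 <= sup (range u) by exact: le_trans (line_bump_ge0 0 bu) (le_sup 0).
move: s0; rewrite le_eqVlt => /orP[/eqP s0|s0]; [left|right; split => //].
  apply/funext => x; apply/eqP; rewrite eq_le (line_bump_ge0 x bu).
  by rewrite [in X in _ <= X]/= s0 le_sup.
move=> r r1; have h : r * sup (range u) < sup (range u) by rewrite gtr_pMl.
have [_ [x _ <-] rx] := sup_gt hs.1 h.
by exists x; rewrite ltr_pdivlMr.
Qed.

(** When u and v both have supremum 1, their superlevel sets are nonempty for the
    same values of r, so the Brunn-Minkowski inequality can be integrated over r;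
    this gives an additive inequality, stronger than the multiplicative one. *)
Lemma additive_prekopa_leindler_line (C D K : R) (s : R) (u v h : R -> R) : 0 < s ->
  line_bump C K u -> line_bump D K v ->
  measurable_fun [set: measurableTypeR R] h -> (forall x, 0 <= h x) ->
  (forall x, u x <= 1) -> (forall x, v x <= 1) ->
  (forall r, r < 1 -> exists x, r < u x) -> (forall r, r < 1 -> exists x, r < v x) ->
  (forall r x y, 0 <= r -> r < u x -> r < v y -> r < h (x + s * y)) ->
  (\int[mu]_x (u x)%:E + s%:E * \int[mu]_x (v x)%:E <= \int[mu]_x (h x)%:E)%E.
Proof.
move=> s0 bu bv mh h0 u1 v1 uex vex uvh.
have mu_ := bu.1; have mv := bv.1.
rewrite !layer_cake//; [|by move=> x; exact: line_bump_ge0 bv|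
  by move=> x; exact: line_bump_ge0 bu].
have mI : measurable `[0:R, +oo[%classic by [].
rewrite -ge0_integralZl//; last 2 first.
- exact: measurable_funTS (measurable_superlevel mv).
- by rewrite lee_fin ltW.
rewrite -ge0_integralD//; last 3 first.
- exact: measurable_funTS (measurable_superlevel mu_).
- by move=> x _; rewrite mule_ge0// lee_fin ltW.
- apply: measurable_funTS; apply: measurable_funeM; exact: measurable_superlevel.
apply: ge0_le_integral => //.
- by move=> x _; rewrite adde_ge0// mule_ge0// lee_fin ltW.
- apply: measurable_funTS; apply: emeasurable_funD; first exact: measurable_superlevel.
  by apply: measurable_funeM; exact: measurable_superlevel.
- exact: measurable_funTS (measurable_superlevel mh).
move=> r; rewrite /= in_itv/= andbT => r0.
have mset (w : R -> R) : measurable_fun [set: measurableTypeR R] w ->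
    measurable [set x | r < w x].
  move=> mw; apply: measurable_set_bool.
  exact: (measurable_fun_ltr (measurable_cst (r : R)) mw).
have [r1|r1] := ltP r 1; last first.
  have E (w : R -> R) : (forall x, w x <= 1) -> [set x | r < w x] = set0.
    by move=> w1; apply/seteqP; split => // x /=; rewrite ltNge (le_trans (w1 x)).
  rewrite (E _ u1) (E _ v1) (measure0 lebesgue_measure) mule0 adde0; exact: measure_ge0.
apply: brunn_minkowski_line => //; [exact: mset..| | | | |].
- exact: line_bump_superlevel_lty bu r0.
- exact: line_bump_superlevel_lty bv r0.
- by have [x] := uex _ r1; exists x.
- by have [x] := vex _ r1; exists x.
- by move=> x y /=; exact: uvh.
Qed.

End prekopa_leindler_line.

Section prekopa_leindler.
Context {R : realType}.
Local Notation mu := (@lebesgue_measure R).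
Local Notation L := (@lebesgue_rV R).

Lemma line_bump_integral C K (u : R -> R) : line_bump C K u ->
  (\int[mu]_x (u x)%:E)%E \is a fin_num.
Proof.
move=> bu; have [mu_ ub] := bu.
have u0 x : 0 <= u x by exact: line_bump_ge0 bu.
apply/fin_numPlt; apply/andP; split.
  by apply: (@lt_le_trans _ _ 0%E) => //; apply: integral_ge0 => x _; rewrite lee_fin.
apply: (@le_lt_trans _ _ (\int[mu]_x (`|C| * \1_(`[- K, K]%classic) x)%:E)%E).
  apply: ge0_le_integral => //.
  - by move=> x _; rewrite lee_fin.
  - exact/measurable_EFinP.
  - apply/measurable_EFinP; apply: measurable_funM => //.
  - move=> x _; rewrite lee_fin; have /andP[_ /le_trans] := ub x; apply.
    by rewrite ler_wpM2r// ler_norm.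
under eq_integral do rewrite EFinM.
rewrite ge0_integralZl//; [|by apply/measurable_EFinP].
rewrite integral_indic// setIT /= lebesgue_measure_itv/=.
by case: ifPn => _; rewrite ?mule0 ?ltry// -EFinB -EFinM ltry.
Qed.

Lemma line_bump_integral_scale C K (u : R -> R) (a : R) : line_bump C K u -> 0 <= a ->
  (\int[mu]_x (u x / a)%:E = (fine (\int[mu]_x (u x)%:E) / a)%:E)%E.
Proof.
move=> bu a0; have [mu_ ub] := bu.
have u0 x : 0 <= u x by exact: line_bump_ge0 bu.
under eq_integral do rewrite EFinM muleC.
rewrite ge0_integralZl//;
  [|by apply/measurable_EFinP|by move=> x _; rewrite lee_fin
   |by rewrite lee_fin invr_ge0].
by rewrite -(fineK (line_bump_integral bu)) -EFinM mulrC.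
Qed.

(** The factor of Prekopa-Leindler per dimension, for exponents 1 - t and t and for
    sums x + s y. With s = lambda t / (1 - t) it equals lambda^t / (1 - t). *)
Definition pl_const (t s : R) : R := (1 - t)^-1 `^ (1 - t) * (s / t) `^ t.

Lemma pl_const_gt0 t s : 0 < t < 1 -> 0 < s -> 0 < pl_const t s.
Proof.
move=> /andP[t0 t1] s0; rewrite mulr_gt0// powR_gt0 ?divr_gt0//.
by rewrite invr_gt0 subr_gt0.
Qed.

(** The additive inequality for u / sup u and v / sup v reads
    U / a + s V / b <= H / c with c = a^(1-t) b^t. The arithmetic-geometric mean
    inequality turns the left-hand side into a multiple of U^(1-t) V^t / c, so
    that the normalizing factors cancel. *)
Lemma prekopa_leindler_line (C D K t s : R) (u v h : R -> R) :
  0 < t < 1 -> 0 < s -> line_bump C K u -> line_bump D K v ->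
  measurable_fun [set: measurableTypeR R] h -> (forall x, 0 <= h x) ->
  (forall x y, u x `^ (1 - t) * v y `^ t <= h (x + s * y)) ->
  ((pl_const t s * (fine (\int[mu]_x (u x)%:E) `^ (1 - t) *
      fine (\int[mu]_x (v x)%:E) `^ t))%:E <= \int[mu]_x (h x)%:E)%E.
Proof.
move=> t01 s0 bu bv mh h0 uvh; have /andP[t0 t1] := t01.
have t1' : 0 < 1 - t by rewrite subr_gt0.
have hh0 : (0 <= \int[mu]_x (h x)%:E)%E by apply: integral_ge0 => x _; rewrite lee_fin.
have ncst (w : R -> R) : 0 < fine (\int[mu]_x (w x)%:E) -> w <> cst 0.
  by move=> /[swap] ->; rewrite /= integral0 ltxx.
have bge0 B (w : R -> R) : line_bump B K w -> 0 <= fine (\int[mu]_x (w x)%:E).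
  by move=> bw; apply/fine_ge0/integral_ge0 => x _; rewrite lee_fin (line_bump_ge0 x bw).
have := bge0 _ _ bu; rewrite le_eqVlt => /orP[/eqP <-|U0].
  by rewrite powR0 ?gt_eqF// mul0r mulr0.
have := bge0 _ _ bv; rewrite le_eqVlt => /orP[/eqP <-|V0].
  by rewrite powR0 ?gt_eqF// mulr0 mulr0.
have [/(ncst _ U0)//|[a0 ua uex]] := line_bump_supP bu.
have [/(ncst _ V0)//|[b0 vb vex]] := line_bump_supP bv.
move: a0 ua uex b0 vb vex; set a := sup (range u); set b := sup (range v).
move=> a0 ua uex b0 vb vex.
set U := fine _ in U0 *; set V := fine _ in V0 *.
pose c := a `^ (1 - t) * b `^ t.
have c0 : 0 < c by rewrite mulr_gt0 ?powR_gt0.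
have scale A (w : R -> R) (d : R) : line_bump A K w -> 0 < d ->
    line_bump (A / d) K (fun x => w x / d).
  move=> [mw wb] d0; split; first exact: measurable_funM.
  move=> x; have /andP[w0 w1] := wb x.
  by rewrite divr_ge0// ?(ltW d0)//= mulrAC ler_wpM2r// invr_ge0 ltW.
have PL : (\int[mu]_x (u x / a)%:E + s%:E * \int[mu]_x (v x / b)%:E
    <= \int[mu]_x (h x / c)%:E)%E.
  apply: (additive_prekopa_leindler_line s0 (scale _ _ _ bu a0) (scale _ _ _ bv b0)) => //.
  - exact: measurable_funM.
  - by move=> x; rewrite divr_ge0// ltW.
  - by move=> x; rewrite ler_pdivrMr// mul1r.
  - by move=> x; rewrite ler_pdivrMr// mul1r.
  - move=> r x y r0; rewrite !ltr_pdivlMr// => ra rb.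
    apply: lt_le_trans (uvh x y).
    have -> : r * c = (r * a) `^ (1 - t) * (r * b) `^ t.
      rewrite !powRM ?(ltW a0) ?(ltW b0)// /c mulrACA; congr (_ * _).
      have [->|r_neq0] := eqVneq r 0; first by rewrite powR0 ?mul0r ?gt_eqF.
      by rewrite -powRD ?subrK ?powRr1//; apply/implyP => _.
    apply: ltr_pM.
    + exact: powR_ge0.
    + exact: powR_ge0.
    + by apply: gt0_ltr_powR; rewrite ?nnegrE ?mulr_ge0 ?(line_bump_ge0 _ bu)// ltW.
    + by apply: gt0_ltr_powR; rewrite ?nnegrE ?mulr_ge0 ?(line_bump_ge0 _ bv)// ltW.
rewrite (line_bump_integral_scale bu (ltW a0)) (line_bump_integral_scale bv (ltW b0)) in PL.
have Hc : (\int[mu]_x (h x / c)%:E = c^-1%:E * \int[mu]_x (h x)%:E)%E.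
  under eq_integral do rewrite EFinM muleC.
  rewrite ge0_integralZl//;
    [by apply/measurable_EFinP|by move=> x _; rewrite lee_fin
     |by rewrite lee_fin invr_ge0 ltW].
rewrite Hc -/U -/V -EFinM -EFinD in PL.
have -> : (\int[mu]_x (h x)%:E = c%:E * (c^-1%:E * \int[mu]_x (h x)%:E))%E.
  by rewrite muleA -EFinM divff ?mul1e// gt_eqF.
apply: le_trans (lee_wpmul2l _ PL); last by rewrite lee_fin ltW.
rewrite -EFinM lee_fin.
(* The two terms of U / a + s V / b, divided by their weights in the mean. *)
pose X := U / ((1 - t) * a); pose Y := s * V / (t * b).
have X0 : 0 < X by rewrite divr_gt0// mulr_gt0.
have Y0 : 0 < Y by rewrite divr_gt0// mulr_gt0.
have -> : U / a + s * (V / b) = (1 - t) * X + t * Y.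
  by rewrite /X /Y; field; rewrite !gt_eqF.
apply: le_trans (ler_wpM2l (ltW c0) (powR_am_gm t01 X0 Y0)).
have -> : X = (1 - t)^-1 * U * a^-1 by rewrite /X; field; rewrite !gt_eqF.
have -> : Y = (s / t) * V * b^-1 by rewrite /Y; field; rewrite !gt_eqF.
have pM (x y z p : R) : 0 < x -> 0 < y -> 0 < z ->
    (x * y * z) `^ p = x `^ p * y `^ p * z `^ p.
  by move=> x0 y0 z0; rewrite !powRM// ltW// mulr_gt0.
rewrite !pM ?invr_gt0 ?divr_gt0//.
have inv (x r : R) : 0 < x -> x^-1 `^ r = (x `^ r)^-1.
  by move=> x0; rewrite -powR_inv1 ?ltW// -powRrM mulN1r powRN.
rewrite (inv a)// (inv b)// /pl_const /c.
have A0 : 0 < a `^ (1 - t) by exact: powR_gt0.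
have B0 : 0 < b `^ t by exact: powR_gt0.
rewrite le_eqVlt; apply/orP; left; apply/eqP.
by field; rewrite !gt_eqF.
Qed.

End prekopa_leindler.

(** * Prekopa-Leindler inequality in arbitrary dimension *)

Section prekopa_leindler_rV.
Context {R : realType}.
Local Notation mu := (@lebesgue_measure R).
Local Notation L := (@lebesgue_rV R).

(** Boxes rather than Euclidean balls: they are the balls of the sup norm, and
    their sections and sums are boxes again. *)
Definition box n (K : R) : set 'rV[R]_n := [set v | forall i, `[- K, K]%classic (v ord0 i)].

Lemma measurable_box n (K : R) : measurable (@box n K).
Proof.
rewrite (_ : box K = \bigcap_(j in [set: 'I_n])
    ((fun v : 'rV[R]_n => v ord0 j : measurableTypeR R) @^-1` `[- K, K]%classic)).
  apply: fin_bigcap_measurable => // j _; rewrite -[X in measurable X]setTI.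
  exact: measurable_rV_coord.
by apply/seteqP; split=> v /= Av j; [move=> _|]; exact: Av.
Qed.

Lemma box_volume_lty n (K : R) : (L n (box K) < +oo)%E.
Proof.
pose I : set (measurableTypeR R) := `[- K, K]%classic.
rewrite /box (lebesgue_rV_box (A := fun=> I)); last by move=> _; exact: measurable_itv.
suff [r ->] : exists r : R, (\prod_(i < n) mu I)%E = r%:E by rewrite ltry.
elim/big_ind : _ => [|x y [r ->] [s ->]|i _]; first by exists 1.
  by exists (r * s).
rewrite /= lebesgue_measure_itv/=; case: ifPn => _; last by exists 0.
by exists (K - - K); rewrite EFinB.
Qed.

Lemma box_rV_cons n (K s : R) (v : 'rV[R]_n) :
  \1_(box K) (rV_cons (s, v)) = \1_(`[- K, K]%classic) s * \1_(box K) v :> R.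
Proof.
rewrite !indicE -natrM mulnb; congr ((nat_of_bool _)%:R).
apply/idP/andP; rewrite !in_setE => h.
  split.
    by have := h ord0; rewrite rV_cons0.
  by move=> j; have := h (lift ord0 j); rewrite rV_consS.
case: h => hs hv i.
by case: (unliftP ord0 i) => [j|] ->; rewrite ?rV_consS ?rV_cons0//; exact: hv.
Qed.

Definition bump n (C K : R) (f : 'rV[R]_n -> R) :=
  measurable_fun setT f /\ forall x, 0 <= f x <= C * \1_(box K) x.

Lemma bump_ge0 n C K (f : 'rV[R]_n -> R) x : bump C K f -> 0 <= f x.
Proof. by case=> _ /(_ x)/andP[]. Qed.

Lemma bump_integral_le n C K (f : 'rV[R]_n -> R) : bump C K f -> 0 <= C ->
  (\int[L n]_x (f x)%:E <= (C * fine (L n (box K)))%:E)%E.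
Proof.
move=> bf C0; have [mf fb] := bf.
have mb : measurable (@box n K) by exact: measurable_box.
have C0' : (0 <= C%:E)%E by rewrite lee_fin.
apply: (@le_trans _ _ (\int[L n]_x (C%:E * (\1_(box K) x)%:E))%E).
  apply: ge0_le_integral => //.
  - by move=> x _; rewrite lee_fin (bump_ge0 x bf).
  - exact/measurable_EFinP.
  - by apply: measurable_funeM; apply/measurable_EFinP; exact: measurable_indic.
  - by move=> x _; rewrite -EFinM lee_fin; have /andP[] := fb x.
have mI : measurable_fun setT (fun x : 'rV[R]_n => (\1_(box K) x : R)%:E).
  by apply/measurable_EFinP; exact: measurable_indic.
rewrite (ge0_integralZl (L n) measurableT mI _ C0')//.
rewrite integral_indic// setIT EFinM fineK// ge0_fin_numE//.
exact: box_volume_lty.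
Qed.

Lemma bump_integral_fin_num n C K (f : 'rV[R]_n -> R) : bump C K f ->
  (\int[L n]_x (f x)%:E)%E \is a fin_num.
Proof.
move=> bf; rewrite ge0_fin_numE; last first.
  by apply: integral_ge0 => x _; rewrite lee_fin (bump_ge0 x bf).
have bf' : bump `|C| K f.
  split; first exact: bf.1.
  move=> x; have /andP[-> /le_trans] := bf.2 x; apply.
  by rewrite ler_wpM2r// ler_norm.
by rewrite (le_lt_trans (bump_integral_le bf' _))// ltry.
Qed.

Lemma bump_slice n C K (f : 'rV[R]_n.+1 -> R) s : bump C K f ->
  bump (C * \1_(`[- K, K]%classic) s) K (fun v => f (rV_cons (s, v))).
Proof.
move=> [mf fb]; split; first exact: measurable_rV_section.
by move=> v; rewrite -mulrA -box_rV_cons; exact: fb.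
Qed.

Definition marginal n (f : 'rV[R]_n.+1 -> R) (s : R) : R :=
  fine (\int[L n]_v (f (rV_cons (s, v)))%:E).

Lemma marginal_bump n C K (f : 'rV[R]_n.+1 -> R) : 0 <= C -> bump C K f ->
  line_bump (C * fine (L n (box K))) K (marginal f).
Proof.
move=> C0 bf; split.
  apply: measurableT_comp; first exact: fine_measurable.
  apply: (measurable_rV_marginal (f := EFin \o f)).
    by apply/measurable_EFinP; exact: bf.1.
  by move=> x; rewrite lee_fin (bump_ge0 x bf).
move=> s; have bs := bump_slice s bf.
apply/andP; split.
  by apply: fine_ge0; apply: integral_ge0 => v _; rewrite lee_fin (bump_ge0 v bs).
rewrite mulrAC -lee_fin (fineK (bump_integral_fin_num bs)).
by apply: bump_integral_le bs _; rewrite mulr_ge0.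
Qed.

(** Tonelli's theorem, with the inner integral brought back to a real number,
    which loses nothing since the sections of a bump have a finite integral. *)
Lemma integral_marginal n C K (f : 'rV[R]_n.+1 -> R) : bump C K f ->
  (\int[L n.+1]_x (f x)%:E = \int[mu]_s (marginal f s)%:E)%E.
Proof.
move=> bf; rewrite (integral_rV_cons (f := EFin \o f)).
- apply: eq_integral => s _.
  by rewrite /marginal (fineK (bump_integral_fin_num (bump_slice s bf))).
- by apply/measurable_EFinP; exact: bf.1.
- by move=> x; rewrite lee_fin (bump_ge0 x bf).
Qed.

(** For fixed first coordinates p and q, the sections of f, g and h satisfy the
    hypothesis in dimension n, so the marginals of f, g and h satisfy it on the
    line up to the constant to the power n. *)
Lemma prekopa_leindler n (C K t s : R) (f g h : 'rV[R]_n -> R) :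
  0 <= C -> 0 < t < 1 -> 0 < s -> bump C K f -> bump C K g -> bump C K h ->
  (forall x y, f x `^ (1 - t) * g y `^ t <= h (x + s *: y)) ->
  pl_const t s ^+ n * (fine (\int[L n]_x (f x)%:E) `^ (1 - t) *
      fine (\int[L n]_x (g x)%:E) `^ t) <= fine (\int[L n]_x (h x)%:E).
Proof.
move=> C0 t01 s0; have c0 := pl_const_gt0 t01 s0.
elim: n C C0 f g h => [|n IHn] C C0 f g h bf bg bh fgh.
  rewrite !integral_rV0/= expr0 mul1r; apply: le_trans (fgh 0 0) _.
  by rewrite scaler0 addr0.
rewrite !(integral_marginal bf, integral_marginal bg, integral_marginal bh).
have F := marginal_bump C0 bf; have G := marginal_bump C0 bg.
have H := marginal_bump C0 bh.
have cn0 : 0 < pl_const t s ^+ n by exact: exprn_gt0.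
have := @prekopa_leindler_line R _ _ K t s (marginal f) (marginal g)
  (fun r => marginal h r / pl_const t s ^+ n) t01 s0 F G.
rewrite (line_bump_integral_scale H (ltW cn0)) lee_fin.
rewrite ler_pdivlMr// exprSr -mulrA [X in _ -> X <= _]mulrC; apply.
- by apply: measurable_funM => //; exact: H.1.
- by move=> r; rewrite divr_ge0 ?(ltW cn0)// (line_bump_ge0 _ H).
move=> r q; rewrite ler_pdivlMr// mulrC.
have wk (w : 'rV[R]_n.+1 -> R) p : bump C K w -> bump C K (fun v => w (rV_cons (p, v))).
  move=> bw; have [mw wb] := bump_slice p bw; split => // v.
  have /andP[-> /le_trans] := wb v; apply.
  by rewrite -mulrA ler_wpM2l// ler_piMl// indicE; case: (_ \in _).
apply: (IHn C C0 _ _ _ (wk f r bf) (wk g q bg) (wk h (r + s * q) bh)) => x y.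
apply: le_trans (fgh _ _) _.
by rewrite addrC rV_cons_affine [s * q + r]addrC [s *: y + x]addrC.
Qed.

End prekopa_leindler_rV.

(** * Measurability of continuous functions and first-order expansions *)

Section continuous_measurable.
Context {R : realType}.

Definition rV_floor n (k : nat) (x : 'rV[R]_n) : 'rV[int]_n :=
  \row_i Num.floor (x ord0 i * k.+1%:R).

Definition rV_grid n (k : nat) (z : 'rV[int]_n) : 'rV[R]_n :=
  \row_i ((z ord0 i)%:~R / k.+1%:R).

Lemma rV_grid_floor n k (x : 'rV[R]_n) : `|x - rV_grid k (rV_floor k x)| <= k.+1%:R^-1.
Proof.
rewrite [leLHS]/Num.norm /= mx_normrE; apply/bigmax_leP; split; first by rewrite invr_ge0.
move=> [i j] _ /=; rewrite !mxE (ord1 i).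
set y := x ord0 j.
have k0 : 0 < k.+1%:R :> R by rewrite ltr0n.
have -> : y - (Num.floor (y * k.+1%:R))%:~R / k.+1%:R =
    (y * k.+1%:R - (Num.floor (y * k.+1%:R))%:~R) / k.+1%:R.
  by field; rewrite gt_eqF.
rewrite normrM normfV (gtr0_norm k0) ler_piMl ?invr_ge0 ?(ltW k0)//.
have h := floor_itv (y * k.+1%:R); move/andP: h => [h1 h2].
rewrite ger0_norm ?subr_ge0// lerBlDl.
by move: h2; rewrite intrD => /ltW.
Qed.

(** The sigma-algebra is generated by the coordinates, not by the open sets; a
    continuous function is the pointwise limit of its values on finer and finer
    grids, which are countably valued and measurable. *)
Lemma continuous_measurable_rV n (f : 'rV[R]_n -> R) :
  continuous f -> measurable_fun setT f.
Proof.
move=> cf; apply: (@measurable_fun_cvg _ _ _ setT (fun k x => f (rV_grid k (rV_floor k x)))).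
  move=> k _ Y mY; rewrite setTI.
  rewrite (_ : _ @^-1` Y = \bigcup_z ([set x : 'rV[R]_n | Y (f (rV_grid k z))] `&`
      \bigcap_(i in [set: 'I_n]) ((fun x : 'rV[R]_n => x ord0 i : measurableTypeR R) @^-1`
      [set y | Num.floor (y * k.+1%:R) = z ord0 i]))).
    apply: countable_bigcupT_measurable => [|z]; first exact: countableP.
    apply: measurableI.
      have [Yz|nYz] := pselect (Y (f (rV_grid k z))).
        by rewrite (_ : mkset _ = setT)//; apply/seteqP; split.
      by rewrite (_ : mkset _ = set0)//; apply/seteqP; split.
    apply: fin_bigcap_measurable => // i _.
    rewrite -[X in measurable X]setTI; apply: measurable_rV_coord => //.
    rewrite (_ : mkset _ = [set y : R | (z ord0 i)%:~R <= y * k.+1%:R < (z ord0 i + 1)%:~R]).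
      apply: measurable_set_bool.
      apply: measurable_and.
        by apply: measurable_fun_ler; [exact: measurable_cst|exact: measurable_funM].
      by apply: measurable_fun_ltr; [exact: measurable_funM|exact: measurable_cst].
    apply/seteqP; split => y /=.
      by move=> <-; exact: floor_itv.
    by move=> /floor_def ->.
  apply/seteqP; split => [x /= Yx|x [z _ [/= Yz xz]]].
    by exists (rV_floor k x) => //=; split => // i _ /=; rewrite mxE.
  rewrite /= (_ : rV_floor k x = z)//; apply/rowP => i; rewrite mxE; exact: (xz i).
move=> x _.
apply: (@cvg_comp _ _ _ (fun k => rV_grid k (rV_floor k x)) f _ (nbhs x));
  last exact: cf.
apply/cvgrPdist_le => e e0.
near=> k; apply: le_trans (rV_grid_floor k x) _; apply: ltW.
near: k; exact: (near_infty_natSinv_lt (PosNum e0)).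
Unshelve. all: by end_near.
Qed.

End continuous_measurable.

Section taylor.
Context {R : realType} {n : nat}.
Implicit Types (g phi : 'rV[R]_n -> R) (x y z : 'rV[R]_n).

Lemma coord_le_norm x i : `|x ord0 i| <= `|x|.
Proof.
rewrite [leRHS]/Num.norm /= mx_normrE.
exact: (@le_bigmax _ _ _ 0 (fun ij : 'I_1 * 'I_n => `|x ij.1 ij.2|) (ord0, i)).
Qed.

Lemma norm_le_coord x (K : R) : 0 <= K -> (forall i, `|x ord0 i| <= K) -> `|x| <= K.
Proof.
move=> K0 h; rewrite [leLHS]/Num.norm /= mx_normrE; apply/bigmax_leP; split => //.
by move=> [i j] _ /=; rewrite (ord1 i).
Qed.

Lemma diff_dotrv g x v : differentiable g x -> 'd g x v = dotrv (grad g x) v.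
Proof.
move=> dg; rewrite /dotrv {1}(row_sum_delta v) linear_sum/=.
by apply: eq_bigr => i _; rewrite linearZ/= -deriveE// /grad mxE mulrC.
Qed.

Lemma line_derive g x v (r : R) : (forall y, differentiable g y) ->
  is_derive r 1 (fun s : R => g (x + s *: v)) (dotrv (grad g (x + r *: v)) v).
Proof.
move=> dg.
have d1 : is_diff r (cst x + *:%R ^~ v) (0 + *:%R ^~ v :> (R -> _)).
  exact: is_diffD.
have d2 := is_diff_comp d1 (differentiableP (dg (x + r *: v))).
have dh : differentiable (fun s : R => g (x + s *: v)) r by case: d2.
apply: DeriveDef; first exact: diff_derivable.
rewrite deriveE//.
rewrite -[LHS]/('d (g \o (cst x + *:%R^~ v)) r 1) (@diff_val _ _ _ _ _ _ _ d2) /= -diff_dotrv//.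
by rewrite fctE/= add0r scale1r.
Qed.

Lemma continuous_grad_coord g i : continuous (grad g) -> continuous (fun x => grad g x ord0 i).
Proof.
move=> cg x.
apply: (@cvg_comp _ _ _ (grad g) (fun v : 'rV[R]_n => v ord0 i) _ (nbhs (grad g x))).
  exact: cg.
exact: coord_continuous.
Qed.

Lemma continuous_C1 g : C1 g -> continuous g.
Proof. by move=> C1g x; apply: differentiable_continuous; exact: C1g.1. Qed.

(** The mean value theorem along the segment from x to x + v. *)
Lemma mean_value g x v : (forall y, differentiable g y) ->
  exists2 c : R, 0 <= c <= 1 & g (x + v) - g x = dotrv (grad g (x + c *: v)) v.
Proof.
move=> dg.
have cont : {within `[0, 1], continuous (fun s : R => g (x + s *: v))}.
  apply: continuous_subspaceT => r; apply: differentiable_continuous.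
  by apply/derivable1_diffP; have [] := line_derive x v r dg.
have [c c01 E] := MVT_segment ler01 (fun r _ => line_derive x v r dg) cont.
exists c; first by move: c01; rewrite in_itv.
by move: E; rewrite scale1r scale0r addr0 subr0 mulr1.
Qed.

Lemma dotrv_le x y : `|dotrv x y| <= n%:R * (`|x| * `|y|).
Proof.
apply: le_trans (ler_norm_sum _ _ _) _.
apply: (@le_trans _ _ (\sum_(i < n) `|x| * `|y|)).
  by apply: ler_sum => i _; rewrite normrM ler_pM// coord_le_norm.
by rewrite sumr_const card_ord mulr_natl.
Qed.

Lemma dotrvBl x y z : dotrv (x - y) z = dotrv x z - dotrv y z.
Proof.
rewrite /dotrv -sumrB; apply: eq_bigr => i _.
by rewrite !mxE mulrBl.
Qed.

Lemma dotrvZl a x y : dotrv (a *: x) y = a * dotrv x y.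
Proof.
by rewrite /dotrv mulr_sumr; apply: eq_bigr => i _; rewrite mxE mulrA.
Qed.

Lemma dotrvZr a x y : dotrv x (a *: y) = a * dotrv x y.
Proof.
by rewrite /dotrv mulr_sumr; apply: eq_bigr => i _; rewrite mxE mulrCA.
Qed.

Lemma compact_box (K : R) : compact (@box R n K).
Proof. by apply: (@rV_compact _ _ (fun=> `[- K, K]%classic)) => _; exact: segment_compact. Qed.

(** Near a point w0, the mean value theorem and the continuity of the gradient at
    w0 give the estimate with a radius d that works for all w close to w0; the
    compactness of the box makes d uniform. *)
Lemma uniform_taylor g (K e : R) : C1 g -> 0 < e ->
  exists2 d : R, 0 < d & forall w v, box K w -> `|v| <= d ->
    `|g (w + v) - g w - dotrv (grad g w) v| <= e * `|v|.
Proof.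
move=> [dg cg] e0.
pose P (d : R) w := forall v, `|v| <= d ->
    `|g (w + v) - g w - dotrv (grad g w) v| <= e * `|v|.
suff : \forall d \near 0^'+, @box R n K `<=` P d.
  move=> near_sub; have [d [d0 Pd]] :=
    filter_ex (filterI (nbhs_right_gt (0 : R)) near_sub).
  by exists d => // w v wK; exact: Pd.
have /compact_near_coveringP := @compact_box K => ncov; apply: ncov => w0 _.
pose e' := e / (2 * n.+1%:R).
have e'0 : 0 < e' by rewrite divr_gt0// mulr_gt0// ltr0n.
have /cvgrPdist_le/(_ _ e'0)/nbhs_ballP[dl /= dl0 hdl] := cg w0.
have dl2 : 0 < dl / 2 by rewrite divr_gt0.
have admissible w d v : ball w0 (dl / 2) w -> d < dl / 2 -> `|v| <= d ->
    `|g (w + v) - g w - dotrv (grad g w) v| <= e * `|v|.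
  move=> w0w ddl vd.
  have [c /andP[c0 c1] ->] := mean_value w v dg.
  have close y : ball w0 dl y -> `|grad g w0 - grad g y| <= e' by move/hdl.
  have h1 : ball w0 dl w by apply: le_ball w0w; lra.
  have h2 : ball w0 dl (w + c *: v).
    apply: ball_splitl; first exact: w0w.
    rewrite -ball_normE/= addrAC subrr add0r normrZ ger0_norm//.
    by apply: le_lt_trans ddl; apply: le_trans vd; rewrite ler_piMl.
  rewrite -dotrvBl; apply: le_trans (dotrv_le _ _) _.
  rewrite mulrA ler_wpM2r//.
  have h3 : `|grad g (w + c *: v) - grad g w| <= e' + e'.
    rewrite (_ : _ - _ = (grad g w0 - grad g w) - (grad g w0 - grad g (w + c *: v))).
      by apply: le_trans (ler_normB _ _) _; apply: lerD; exact: close.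
    by rewrite opprB [RHS]addrC subrKA.
  apply: le_trans (ler_wpM2l _ h3) _ => //.
  have n0 : (0 : R) < n.+1%:R by rewrite ltr0n.
  have E (p q : R) : q != 0 -> p * (e / (2 * q) + e / (2 * q)) = e * (p / q).
    by move=> q0; field.
  rewrite E ?gt_eqF//.
  rewrite ler_piMr ?(ltW e0)// ler_pdivrMr// mul1r ler_nat//.
exists (ball w0 (dl / 2), [set d | d < dl / 2]) => /=.
  split; first exact: nbhsx_ballx.
  exact: nbhs_right_lt.
by move=> [w d] /= [h1 h2] v; exact: admissible.
Qed.

End taylor.

(** * Fenchel transform of a superlinear function *)

Section fenchel_transform.
Context {R : realType} {n : nat}.
Implicit Types (g phi : 'rV[R]_n -> R) (p x y z : 'rV[R]_n).

Lemma norm_le_enorm x : `|x| <= enorm x.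
Proof.
apply: norm_le_coord => [|i]; first exact: sqrtr_ge0.
rewrite -sqrtr_sqr ler_sqrt; last by apply: sumr_ge0 => j _; exact: sqr_ge0.
rewrite /dotrv (bigD1 i)//= -expr2 lerDl.
by apply: sumr_ge0 => j _; exact: sqr_ge0.
Qed.

Lemma enorm_infty_filter : Filter (@enorm_infty R n).
Proof.
apply: filter_from_filter; first by exists 0.
move=> r s _ _; exists (Num.max r s) => // x /=.
by rewrite gt_max => /andP.
Qed.

(** Outside a ball phi dominates K times the norm, and on a box that contains
    this ball phi is bounded below by compactness. *)
Lemma superlinear_growth phi (K : R) : continuous phi -> superlinear phi ->
  exists B, forall z, K * enorm z - phi z <= B.
Proof.
move=> cphi /(@cvgryPge _ _ _ enorm_infty_filter) /(_ K) [r _ hr].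
(* The maximum with 0 keeps the zero vector, where the quotient by the norm
   carries no information, inside the box. *)
pose s := Num.max r 0.
have cb := @compact_box R n s.
have [[z0 z0s]|b0] := pselect (@box R n s !=set0); last first.
  exists 0 => z.
  exfalso; apply: b0; exists 0 => i; rewrite /= in_itv/= mxE.
  by rewrite oppr_le0 /s le_max lexx orbT.
have bne : @box R n s !=set0 by exists z0.
have [w _ wmin] := EVT_min_rV bne cb (continuous_subspaceT cphi).
exists (Num.max 0 (`|K| * s - phi w)) => z.
have [sz|zs] := ltP s (enorm z).
  rewrite le_max; apply/orP; left; rewrite subr_le0.
  have z0' : 0 < enorm z by apply: le_lt_trans sz; rewrite /s le_max lexx orbT.
  rewrite -ler_pdivlMr//; apply: hr => /=.
  by apply: le_lt_trans sz; rewrite /s le_max lexx.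
rewrite le_max; apply/orP; right; apply: lerB.
  apply: le_trans (ler_wpM2r _ (ler_norm K)) _; first exact: sqrtr_ge0.
  by rewrite ler_wpM2l.
apply: wmin; apply/mem_set => i /=; rewrite in_itv/= -ler_norml.
by apply: le_trans zs; apply: le_trans (norm_le_enorm z); exact: coord_le_norm.
Qed.

Lemma fenchel_ge phi p z : ((dotrv p z - phi z)%:E <= fenchel phi p)%E.
Proof. by apply: ereal_sup_ubound; exists z. Qed.

Lemma fenchel_bound phi (K : R) : continuous phi -> superlinear phi ->
  exists B : R, forall p, `|p| <= K -> (fenchel phi p <= B%:E)%E.
Proof.
move=> cphi sphi; have [B hB] := superlinear_growth (n%:R * K) cphi sphi.
exists B => p pK; apply: ge_ereal_sup => _ [z _ <-]; rewrite lee_fin.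
apply: le_trans (hB z); rewrite lerB// (le_trans (ler_norm _))//.
apply: le_trans (dotrv_le _ _) _; rewrite -mulrA ler_wpM2l//.
by apply: ler_pM => //; exact: norm_le_enorm.
Qed.

Lemma fenchel_fin_num phi p : continuous phi -> superlinear phi ->
  fenchel phi p \is a fin_num.
Proof.
move=> cphi sphi; have [B /(_ p (lexx _)) hB] := fenchel_bound `|p| cphi sphi.
by rewrite fin_numE (gt_eqF (lt_le_trans (ltNyr _) (fenchel_ge phi p 0)))
   (lt_eqF (le_lt_trans hB (ltry _))).
Qed.

Lemma fenchel_bound_box phi g (lambda K : R) : continuous phi -> superlinear phi ->
  continuous (grad g) ->
  exists B : R, forall x, box K x -> `|fine (fenchel phi (- lambda *: grad g x))| <= B.
Proof.
move=> cphi sphi cg.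
have [K' gK'] : exists K' : R, forall x, box K x -> `|grad g x| <= K'.
  have [[z0 z0s]|b0] := pselect (@box R n K !=set0); last first.
    by exists 0 => x bx; exfalso; apply: b0; exists x.
  have bne : @box R n K !=set0 by exists z0.
  have cng : continuous (fun x => `|grad g x|).
    move=> x; apply: (@cvg_comp _ _ _ (grad g) (fun v : 'rV[R]_n => `|v|) _ (nbhs (grad g x))).
      exact: cg.
    exact: norm_continuous.
  have [w _ wmax] := EVT_max_rV bne (@compact_box R n K) (continuous_subspaceT cng).
  by exists `|grad g w| => x xK; apply: wmax; exact: mem_set.
have [B hB] := fenchel_bound (`|lambda| * K') cphi sphi.
exists (Num.max B (phi 0)) => x xK.
have fx := fenchel_fin_num (- lambda *: grad g x) cphi sphi.
rewrite ler_norml lerNl; apply/andP; split.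
  rewrite le_max; apply/orP; right; rewrite lerNl -lee_fin (fineK fx).
  have := fenchel_ge phi (- lambda *: grad g x) 0.
  by rewrite /dotrv big1 ?sub0r// => i _; rewrite !mxE mulr0.
rewrite le_max -lee_fin (fineK fx) hB// normrZ normrN.
by rewrite ler_wpM2l// gK'.
Qed.

End fenchel_transform.

(** * Integrals over large boxes *)

Section box_integrals.
Context {R : realType} {n : nat}.
Local Notation L := (@lebesgue_rV R n).
Implicit Types (f g h phi : 'rV[R]_n -> R).

Lemma box_subset (K K' : R) : K <= K' -> @box R n K `<=` box K'.
Proof.
move=> KK' x xK i; have := xK i; rewrite /= !in_itv/= => /andP[h1 h2].
by rewrite (le_trans _ h1) ?lerN2// (le_trans h2).
Qed.

Lemma bounded_box_integrable f (K C : R) : measurable_fun setT f ->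
  (forall x, box K x -> `|f x| <= C) -> L.-integrable (box K) (EFin \o f).
Proof.
move=> mf fC; apply: measurable_bounded_integrable.
- exact: measurable_box.
- exact: box_volume_lty.
- exact: measurable_funTS.
- exists C; split; first exact: num_real.
  by move=> M CM x xK; apply: le_trans (fC x xK) (ltW CM).
Qed.

Lemma continuous_box_bound f (K : R) : continuous f ->
  exists2 C, 0 <= C & forall x, box K x -> `|f x| <= C.
Proof.
move=> cf; have [[z0 z0s]|b0] := pselect (@box R n K !=set0); last first.
  by exists 0 => // x xK; exfalso; apply: b0; exists x.
have bne : @box R n K !=set0 by exists z0.
have cnf : continuous (fun x => `|f x|).
  move=> x; apply: (@cvg_comp _ _ _ f Num.norm _ (nbhs (f x))); first exact: cf.
  exact: norm_continuous.
have [w _ wmax] := EVT_max_rV bne (@compact_box R n K) (continuous_subspaceT cnf).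
by exists `|f w| => // x xK; apply: wmax; exact: mem_set.
Qed.

Lemma continuous_box_integrable f (K : R) : continuous f ->
  L.-integrable (box K) (EFin \o f).
Proof.
move=> cf; have [C _ fC] := continuous_box_bound K cf.
exact: (bounded_box_integrable (continuous_measurable_rV cf) fC).
Qed.

Lemma bigcup_box : \bigcup_k (@box R n k%:R) = setT.
Proof.
apply/seteqP; split => // x _.
exists (Num.truncn `|x|).+1 => //= i /=; rewrite in_itv/= -ler_norml.
apply: le_trans (coord_le_norm x i) _.
exact/ltW/truncnS_gt.
Qed.

(** The integrals of |f| over the boxes of integer size converge to the whole
    integral by monotone convergence, and the tail of f outside a larger box is
    dominated by the tail of |f| outside a smaller one. *)
Lemma Rintegral_box_tail f (e : R) : L.-integrable setT (EFin \o f) -> 0 < e ->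
  exists2 K, 0 <= K & forall M, K <= M ->
    `|(\int[L]_x f x) - (\int[L]_(x in box M) f x)| <= e.
Proof.
move=> fi e0.
have fiE (D : set 'rV[R]_n) : measurable D -> L.-integrable D (EFin \o f).
  by move=> mD; apply: integrableS fi.
have nfi := integrable_norm fi.
have nfiE (D : set 'rV[R]_n) : measurable D -> L.-integrable D (EFin \o (fun x => `|f x|)).
  by move=> mD; apply: integrableS nfi.
have mb (M : R) : measurable (@box R n M) by exact: measurable_box.
have split_box h (M : R) : L.-integrable setT (EFin \o h) ->
    \int[L]_x h x = \int[L]_(x in box M) h x + \int[L]_(x in ~` box M) h x.
  move=> hi; rewrite -Rintegral_setU ?setUv//; first exact: measurableC.
  exact/disj_setPCl.
have cvg_box : (fun k => \int[L]_(x in box k%:R) `|f x|) @ \oo --> \int[L]_x `|f x|.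
  apply: fine_cvg; rewrite fineK; last exact: integrable_fin_num nfi.
  rewrite -bigcup_box; apply: ge0_nondecreasing_set_cvg_integral => //.
  - move=> i j ij; apply/subsetPset; apply: box_subset; by rewrite ler_nat.
  - by move=> i; apply: measurable_funTS; case/integrableP: nfi.
move/cvgrPdist_le : cvg_box => /(_ _ e0) [k _ /(_ k (leqnn k))] hk.
exists k%:R => // M kM.
rewrite (split_box f M fi) addrAC subrr add0r.
apply: le_trans (le_normr_Rintegral _ _) _; [exact: measurableC| |].
  by apply: fiE; exact: measurableC.
have E K : \int[L]_(x in ~` box K) `|f x| = \int[L]_x `|f x| - \int[L]_(x in box K) `|f x|.
  by rewrite (split_box _ K nfi) addrAC subrr add0r.
rewrite E; apply: le_trans hk; apply: le_trans (ler_norm _).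
apply: lerB => //.
rewrite -(setDUK (box_subset kM)) Rintegral_setU//.
- by rewrite lerDl; apply: Rintegral_ge0 => x _.
- exact: measurableD.
- by rewrite setDUK; [exact: nfiE|exact: box_subset].
- by apply/disj_setPS => x [h [_ nh]].
Qed.

End box_integrals.

(** * Small perturbations of the density *)

Section prekopa_leindler_box.
Context {R : realType} {n : nat}.
Local Notation L := (@lebesgue_rV R n).
Implicit Types (f g h phi psi : 'rV[R]_n -> R).

Lemma box_addZ (M r s : R) (x y : 'rV[R]_n) : 0 <= s ->
  box M x -> box r y -> box (M + s * r) (x + s *: y).
Proof.
move=> s0 xM yr i; move: (xM i) (yr i).
rewrite /= !in_itv/= -!ler_norml !mxE => h1 h2.
apply: le_trans (ler_normD _ _) _; apply: lerD => //.
by rewrite normrM ger0_norm// ler_wpM2l.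
Qed.

Lemma expR_box_bump g (C K K' : R) : measurable_fun setT g -> K <= K' ->
  (forall x, box K x -> g x <= C) -> bump (expR C) K' ((expR \o g) \_ (box K)).
Proof.
move=> mg KK' gC; split.
  apply/(measurable_restrictT _ _).1; first exact: measurable_box.
  by apply: measurable_funTS; exact: measurableT_comp.
move=> x; rewrite patchE; case: ifPn => [/set_mem xK|_] /=; last first.
  by rewrite lexx mulr_ge0// expR_ge0.
rewrite expR_ge0/= indicE mem_set ?mulr1 ?ler_expR ?gC//.
exact: box_subset xK.
Qed.

Lemma ln_pl_const (t lambda : R) : 0 < t < 1 -> 0 < lambda ->
  ln (pl_const t (lambda * (t / (1 - t)))) = t * ln lambda - ln (1 - t).
Proof.
move=> /andP[t0 t1] l0; have t1' : 0 < 1 - t by rewrite subr_gt0.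
rewrite /pl_const (_ : _ / t = lambda / (1 - t)); last by field; rewrite !gt_eqF.
rewrite lnM ?posrE ?powR_gt0 ?divr_gt0 ?invr_gt0//.
rewrite !ln_powR ln_div ?posrE// lnV ?posrE//; ring.
Qed.

(** Prekopa-Leindler for e^g and e^-phi cut to boxes. The lower bound is put in
    the form F (1 + t L), ready for comparison at first order in t: the logarithm
    of the bound is n (t ln lambda - ln (1 - t)) + (1 - t) ln F + t ln P, which is
    at least ln F + t L since - ln (1 - t) >= t, and e^(t L) >= 1 + t L. *)
Lemma prekopa_leindler_box (phi g psi : 'rV[R]_n -> R) (t lambda M r : R) :
  0 < t < 1 -> 0 < lambda -> 0 <= r ->
  continuous phi -> continuous g -> measurable_fun setT psi ->
  let s := lambda * (t / (1 - t)) in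
  (exists C, forall x, box (M + s * r) x -> psi x <= C) ->
  (forall x y, box M x -> box r y ->
     (1 - t) * g x - t * phi y <= psi (x + s *: y)) ->
  let F := \int[L]_(x in box M) expR (g x) in
  let P := \int[L]_(y in box r) expR (- phi y) in
  0 < F -> 0 < P ->
  F * (1 + t * (n%:R * ln lambda + n%:R + ln P - ln F)) <=
    \int[L]_(x in box (M + s * r)) expR (psi x).
Proof.
move=> t01 l0 r0 cphi cg mpsi s [C psiC] admissible F P F0 P0.
have /andP[t0 t1] := t01; have t1' : 0 < 1 - t by rewrite subr_gt0.
have s0 : 0 < s by rewrite mulr_gt0// divr_gt0.
have [Cg Cg0 gC] := continuous_box_bound M cg.
have [Cp Cp0 pC] := continuous_box_bound r cphi.
pose K := Num.max (M + s * r) r.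
pose C' := Num.max C (Num.max Cg Cp).
have MK : M <= K by rewrite le_max lerDl mulr_ge0// ltW.
have bf : bump (expR C') K ((expR \o g) \_ (box M)).
  apply: expR_box_bump => //; first exact: continuous_measurable_rV.
  by move=> x xM; rewrite !le_max (le_trans (ler_norm _) (gC x xM)) orbT.
have bp : bump (expR C') K ((expR \o (fun y => - phi y)) \_ (box r)).
  apply: expR_box_bump => //.
  - by apply: continuous_measurable_rV => x; apply: continuousN; exact: cphi.
  - by rewrite le_max lexx orbT.
  - move=> x xr; rewrite !le_max; apply/orP; right; apply/orP; right.
    by apply: le_trans (pC x xr); rewrite -normrN ler_norm.
have bh : bump (expR C') K ((expR \o psi) \_ (box (M + s * r))).
  apply: expR_box_bump => //; first by rewrite le_max lexx.
  by move=> x xM; rewrite !le_max psiC.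
have hfgh x y : ((expR \o g) \_ (box M)) x `^ (1 - t) *
    ((expR \o (fun y => - phi y)) \_ (box r)) y `^ t <=
    ((expR \o psi) \_ (box (M + s * r))) (x + s *: y).
  rewrite !patchE; case: ifPn => [/set_mem xM|_]; last first.
    rewrite powR0 ?gt_eqF// mul0r.
    by case: ifPn => _ //=; exact: expR_ge0.
  case: ifPn => [/set_mem yr|_]; last first.
    rewrite [X in _ * X]powR0 ?gt_eqF// mulr0.
    by case: ifPn => _ //=; exact: expR_ge0.
  rewrite mem_set; last exact: box_addZ (ltW s0) xM yr.
  rewrite /= /powR !gt_eqF ?expR_gt0// !expRK -expRD ler_expR mulrN.
  exact: admissible.
have := prekopa_leindler (expR_ge0 _) t01 s0 bf bp bh hfgh.
have E h D : fine (\int[L]_x ((expR \o h) \_ D x)%:E) = \int[L]_(x in D) expR (h x).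
  by rewrite [RHS]Rintegral_mkcond.
rewrite (E g) (E (fun y => - phi y)) (E psi) -/F -/P.
clearbody F P; apply: le_trans.
have c0 : 0 < pl_const t s by exact: pl_const_gt0.
have -> : pl_const t s ^+ n * (F `^ (1 - t) * P `^ t) =
    expR (n%:R * (t * ln lambda - ln (1 - t)) + (1 - t) * ln F + t * ln P).
  rewrite !expRD -ln_pl_const// -/s mulrA.
  by rewrite expRM_natl lnK// /powR !gt_eqF.
rewrite -{1}(lnK F0).
pose A := n%:R * ln lambda + n%:R + ln P - ln F.
apply: (@le_trans _ _ (expR (ln F) * expR (t * A))).
  by rewrite ler_pM2l ?expR_gt0// expR_ge1Dx.
rewrite -expRD ler_expR -subr_ge0 /A.
rewrite [leRHS](_ : _ = n%:R * (- t - ln (1 - t))); last by ring.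
rewrite mulr_ge0// subr_ge0.
by apply: le_ln1Dx; rewrite ltrN2.
Qed.

(** From e^(-x) >= 1 - x one gets e^x <= 1 / (1 - x), and
    (1 - x) (1 + x + 2 x^2) = 1 + x^2 (1 - 2 x) >= 1 for x <= 1/2. *)
Lemma expR_le_quadratic (x : R) : `|x| <= 1 / 2 -> expR x <= 1 + x + 2 * x ^+ 2.
Proof.
rewrite ler_norml => /andP[x1 x2].
have h : 0 < 1 - x by lra.
have e1 : expR x * (1 - x) <= 1.
  have := expR_ge1Dx (- x) => h1.
  by rewrite -[leRHS](expRxMexpNx_1 x) ler_pM2l ?expR_gt0.
rewrite -(ler_pM2r h); apply: le_trans e1 _.
nra.
Qed.

(** Expansion of t |-> int e^(g + t psi) with a second-order remainder controlled
    by the bound of |psi| on the box. *)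
Lemma exp_perturbation_le g psi (t K C : R) : continuous g -> measurable_fun setT psi ->
  0 < t -> (forall x, box K x -> `|psi x| <= C) -> t * C <= 1 / 2 ->
  \int[L]_(x in box K) expR (g x + t * psi x) <=
  (1 + 2 * t ^+ 2 * C ^+ 2) * \int[L]_(x in box K) expR (g x) +
   t * \int[L]_(x in box K) (psi x * expR (g x)).
Proof.
move=> cg mpsi t0 psiC tC.
have mg := continuous_measurable_rV cg.
have mK : measurable (@box R n K) by exact: measurable_box.
have [Cg Cg0 gC] := continuous_box_bound K cg.
have ge x : box K x -> expR (g x) <= expR Cg.
  by move=> xK; rewrite ler_expR (le_trans (ler_norm _))// gC.
have i1 : L.-integrable (box K) (EFin \o (fun x => expR (g x))).
  apply: (bounded_box_integrable (C := expR Cg)).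
    exact: measurableT_comp.
  by move=> x xK; rewrite ger0_norm ?expR_ge0// ge.
have i2 : L.-integrable (box K) (EFin \o (fun x => psi x * expR (g x))).
  apply: (bounded_box_integrable (C := C * expR Cg)).
    by apply: measurable_funM => //; exact: measurableT_comp.
  by move=> x xK; rewrite normrM ler_pM// ?psiC// ger0_norm ?expR_ge0// ge.
have i3 : L.-integrable (box K) (EFin \o (fun x => expR (g x + t * psi x))).
  apply: (bounded_box_integrable (C := expR (Cg + t * C))).
    by apply: measurableT_comp => //; apply: measurable_funD => //; exact: measurable_funM.
  move=> x xK; rewrite ger0_norm ?expR_ge0// ler_expR lerD//.
    by rewrite (le_trans (ler_norm _))// gC.
  by rewrite ler_pM2l// (le_trans (ler_norm _))// psiC.
have i4 : L.-integrable (box K) (EFin \o (fun x => (1 + 2 * t ^+ 2 * C ^+ 2) * expR (g x))).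
  exact: (integrableZl mK (1 + 2 * t ^+ 2 * C ^+ 2) i1).
have i5 : L.-integrable (box K) (EFin \o (fun x => t * (psi x * expR (g x)))).
  exact: (integrableZl mK t i2).
rewrite -RintegralZl// -RintegralZl// -RintegralD//.
apply: le_Rintegral => //.
  exact: (integrableD mK i4 i5).
move=> x xK; rewrite expRD mulrA -mulrDl mulrC ler_pM2r ?expR_gt0//.
have tp : `|t * psi x| <= t * C by rewrite normrM gtr0_norm// ler_pM2l// psiC.
apply: le_trans (expR_le_quadratic (le_trans tp tC)) _.
rewrite [in leRHS]addrAC lerD2l -mulrA ler_pM2l// -exprMn -real_normK ?num_real//.
by rewrite lerXn2r ?nnegrE// (le_trans _ tp).
Qed.

End prekopa_leindler_box.

(** * Differentiation of the Prekopa-Leindler inequality *)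

(** Otherwise all the k increments would exceed e / k and their sum would exceed
    e. *)
Lemma pigeonhole_increment {R : realType} (u : nat -> R) (k : nat) (e : R) :
  (0 < k)%N -> u k - u 0%N <= e ->
  exists2 j, (j < k)%N & u j.+1 - u j <= e / k%:R.
Proof.
move=> k0 uk; apply: contrapT => h.
have k0' : (0 : R) < k%:R by rewrite ltr0n.
have : \sum_(0 <= j < k) (e / k%:R) < \sum_(0 <= j < k) (u j.+1 - u j).
  rewrite !big_mkord; apply: ltr_sum => [|j _].
    by apply/hasP; exists (Ordinal k0) => //; rewrite mem_index_enum.
  by rewrite ltNge; apply/negP => hj; apply: h; exists j.
rewrite telescope_sumr// sumr_const_nat subn0 -[ltLHS]mulr_natr divfK ?gt_eqF//.
by rewrite ltNge uk.
Qed.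

Lemma step_gain_arith {R : realFieldType} (t A LL C G q d F : R) :
  A * (1 + t * LL) <= (1 + 2 * t ^+ 2 * C ^+ 2) * G + t * (q + d * G) ->
  G <= A + 2 * t * d -> 2 * t ^+ 2 * C ^+ 2 * G <= t * d ->
  t * (d * G) <= t * (d * F) -> t * (A * LL) <= t * (q + (3 + F) * d).
Proof. by lra. Qed.

Lemma tangent_weight_arith {R : realFieldType} (t lambda X Y W A D E d P : R) :
  (1 - t) * X <= (1 - t) * (W - A + E) -> (1 - t) * A = t * (lambda * D) ->
  (1 - t) * E <= t * d -> t * (- lambda * D - Y) <= t * P ->
  (1 - t) * X - t * Y <= W + t * (P + d - W).
Proof. by lra. Qed.

Lemma vanishing_loss_arith {R : realFieldType} (A F K0 d K1 Q q : R) :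
  A * (K0 - d) <= q + (3 + F) * d -> q <= Q + d ->
  (F - A) * K0 <= d * K1 -> d * A <= d * F ->
  F * K0 <= Q + d * (4 + 2 * F + K1).
Proof. by lra. Qed.

Lemma log_loss_arith {R : realFieldType} (a p d b F : R) :
  - d <= p -> b <= F -> a - F - d <= a + p - b.
Proof. by lra. Qed.

Section entropy_inequality.
Context {R : realType} {n : nat}.
Local Notation L := (@lebesgue_rV R n).
(* Phi stands for phi^*(- lambda grad g), which enters the argument through
   Young's inequality. *)
Context (phi g Phi : 'rV[R]_n -> R) (lambda : R)
  (l0 : 0 < lambda) (cphi : continuous phi) (C1g : C1 g)
  (mPhi : measurable_fun setT Phi)
  (PhiB : forall K, exists B, forall x, box K x -> `|Phi x| <= B)
  (Phige : forall w y, dotrv (- lambda *: grad g w) y - phi y <= Phi w)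
  (phii : L.-integrable setT (EFin \o (fun x => expR (- phi x))))
  (phi1 : \int[L]_x expR (- phi x) = 1)
  (gi : L.-integrable setT (EFin \o (fun x => expR (g x))))
  (Qi : L.-integrable setT (EFin \o (fun x => (Phi x - g x) * expR (g x)))).
Let F := \int[L]_x expR (g x).
Let Q := \int[L]_x ((Phi x - g x) * expR (g x)).
Context (F0 : 0 < F).
Let FM M := \int[L]_(x in box M) expR (g x).
Let QM M := \int[L]_(x in box M) ((Phi x - g x) * expR (g x)).

Let cg : continuous g := continuous_C1 C1g.

Lemma Rintegral_box_mono f (M M' : R) : M <= M' -> (forall x, 0 <= f x) ->
  L.-integrable setT (EFin \o f) ->
  \int[L]_(x in box M) f x <= \int[L]_(x in box M') f x.
Proof.
move=> MM' f0 fi.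
have mb (K : R) : measurable (@box R n K) by exact: measurable_box.
have sub : @box R n M `<=` box M' by exact: box_subset.
rewrite -(setDUK sub) Rintegral_setU//.
- by rewrite lerDl; apply: Rintegral_ge0.
- exact: measurableD.
- by rewrite setDUK//; apply: integrableS fi.
- by apply/disj_setPS => x [h [_ nh]].
Qed.

Lemma box_mass_mono M M' : M <= M' -> FM M <= FM M'.
Proof. by move=> MM'; apply: Rintegral_box_mono => // x; exact: expR_ge0. Qed.

Lemma box_mass_le M : FM M <= F.
Proof.
apply/ler_addgt0Pr => e e0.
have [K1 _ h] := Rintegral_box_tail gi e0.
apply: le_trans (box_mass_mono (M' := Num.max M K1) _) _; first by rewrite le_max lexx.
have := h (Num.max M K1); rewrite le_max lexx orbT => /(_ isT).
by rewrite ler_norml lerNl opprB lerBlDl => /andP[h1 _].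
Qed.

(** The estimate at fixed cut-offs, with errors of order d. It is obtained for
    t = 1 / (k + 2), that is s = lambda / (k + 1), with k so large that the
    first-order expansion of g holds at the scale s r and that the second-order
    terms in t are at most t d. *)
Lemma entropy_step (d r M0 : R) : 0 < d -> 0 <= r -> 0 <= M0 ->
  (forall M, M0 <= M -> 0 < FM M) ->
  0 < \int[L]_(y in box r) expR (- phi y) ->
  F - FM M0 <= d ->
  exists M M', [/\ M0 <= M, M <= M' &
    FM M * (n%:R * ln lambda + n%:R + ln (\int[L]_(y in box r) expR (- phi y)) - ln (FM M))
      <= QM M' + (3 + F) * d].
Proof.
move=> d0 r0 M00 FM0 P0 FMd.
set P := \int[L]_(y in box r) _ in P0 *.
pose N := M0 + lambda * r.
have [Cg Cg0 gC] := continuous_box_bound N cg.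
have [CP PC] := PhiB N.
pose C := `|CP| + Cg + d.
have C0 : 0 < C by rewrite ltr_wpDl// addr_ge0.
(* A displacement s y has norm at most s r, and (1 - t) s = lambda t: this slope
   error costs at most t d in the exponent. *)
pose e := d / (lambda * (r + 1)).
have r1 : 0 < r + 1 by rewrite ltr_wpDl.
have e0 : 0 < e by rewrite divr_gt0// mulr_gt0.
have [eta eta0 taylor] := uniform_taylor N C1g e0.
have [k [k1 k2 k3]] : exists k : nat, [/\ lambda * r / k.+1%:R <= eta,
    (k.+2%:R : R)^-1 * C <= 1 / 2 & (k.+2%:R : R)^-1 * (2 * C ^+ 2 * F) <= d].
  have x1 : 0 <= lambda * r / eta
    by apply: divr_ge0; [apply: mulr_ge0 => //; exact: ltW|exact: ltW].
  have x2 : 0 <= 2 * C by apply: mulr_ge0 => //; exact: ltW.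
  have x3 : 0 <= 2 * C ^+ 2 * F / d.
    by rewrite divr_ge0 ?(ltW d0)// mulr_ge0 ?(ltW F0)// mulr_ge0 ?sqr_ge0.
  pose X := lambda * r / eta + 2 * C + 2 * C ^+ 2 * F / d.
  have Xk := truncnS_gt X; set k := Num.truncn X in Xk.
  have k0 : (0 : R) < k.+1%:R by rewrite ltr0n.
  have k20 : (0 : R) < k.+2%:R by rewrite ltr0n.
  have kk : k.+1%:R <= k.+2%:R :> R by rewrite ler_nat.
  exists k; split.
  - rewrite ler_pdivrMr// -ler_pdivrMl// mulrC; apply: le_trans (ltW Xk).
    by rewrite /X -addrA lerDl addr_ge0.
  - rewrite ler_pdivrMl// mulrA mulr1 ler_pdivlMr// mulrC.
    apply: le_trans kk; apply: le_trans (ltW Xk).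
    by rewrite /X addrAC lerDr addr_ge0.
  - rewrite ler_pdivrMl// -ler_pdivrMr//.
    apply: le_trans kk; apply: le_trans (ltW Xk).
    by rewrite /X lerDr addr_ge0.
pose t := (k.+2%:R : R)^-1.
have k0 : (0 : R) < k.+1%:R by rewrite ltr0n.
have k20 : (0 : R) < k.+2%:R by rewrite ltr0n.
have t0 : 0 < t by rewrite invr_gt0.
have kE : k.+2%:R = k.+1%:R + 1 :> R by rewrite -natr1.
have t01 : 0 < t < 1 by rewrite t0 invf_lt1// kE ltrDr.
have tE : t / (1 - t) = k.+1%:R^-1.
  have k2n : k.+1%:R + 1 != 0 :> R by rewrite -kE gt_eqF.
  rewrite /t kE (_ : 1 - _ = k.+1%:R / (k.+1%:R + 1)); last by field.
  by rewrite invf_div mulKf// .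
have t2 : k.+1%:R^-1 <= 2 * t.
  rewrite /t -lef_pV2 ?posrE ?mulr_gt0 ?invr_gt0// invrK invfM invrK.
  rewrite ler_pdivrMl// kE mulrDl mul1r lerD2l.
  by rewrite ler1n.
pose s := lambda * (t / (1 - t)).
have sE : s = lambda / k.+1%:R by rewrite /s tE.
have s0 : 0 < s by rewrite sE divr_gt0.
(* Among the k + 1 shells of thickness s r between the boxes of size M0 and N,
   one has a mass of at most d / (k + 1), which is O(t d). *)
pose u j := FM (M0 + j%:R * (s * r)).
have ukE : M0 + k.+1%:R * (s * r) = N.
  by rewrite sE /N; field; rewrite gt_eqF.
have uk : u k.+1 - u 0%N <= d.
  rewrite /u mul0r addr0; apply: le_trans FMd.
  by apply: lerB; [exact: box_mass_le|exact: lexx].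
have [j jk hj] := pigeonhole_increment (ltn0Sn k) uk.
pose M := M0 + j%:R * (s * r).
have sr0 : 0 <= s * r by rewrite mulr_ge0// ltW.
have M0M : M0 <= M by rewrite lerDl mulr_ge0.
have uj1 : u j.+1 = FM (M + s * r).
  by rewrite /u /M -natr1 mulrDl mul1r addrA.
have MN : M + s * r <= N.
  rewrite -ukE /M -addrA lerD2l -{2}[s * r]mul1r -mulrDl ler_wpM2r//.
  by rewrite natr1 ler_nat.
exists M, (M + s * r); split => //; first by rewrite lerDl.
(* The summand d absorbs the error of the first-order expansion of g. *)
pose Psi x := Phi x + d - g x.
have mPsi : measurable_fun setT Psi.
  apply: measurable_funB; last exact: continuous_measurable_rV cg.
  by apply: measurable_funD.
have PsiC x : box (M + s * r) x -> `|Psi x| <= C.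
  move=> /(box_subset MN) xN; apply: le_trans (ler_normB _ _) _.
  rewrite /C [leRHS]addrAC lerD ?gC//; apply: le_trans (ler_normD _ _) _.
  rewrite (gtr0_norm d0) lerD2r; exact: le_trans (PC x xN) (ler_norm _).
pose psi x := g x + t * Psi x.
have mpsi : measurable_fun setT psi.
  apply: measurable_funD; first exact: continuous_measurable_rV cg.
  exact: measurable_funM.
have admissible x y : box M x -> box r y -> (1 - t) * g x - t * phi y <= psi (x + s *: y).
  move=> xM yr; set w := x + s *: y.
  have wN : box N w by apply: (box_subset MN); exact: box_addZ (ltW s0) xM yr.
  have ny : `|y| <= r.
    by apply: norm_le_coord => // i; have := yr i; rewrite /= in_itv/= ler_norml.
  have nv : `|- (s *: y)| <= s * r by rewrite normrN normrZ gtr0_norm// ler_pM2l.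
  have h := taylor w (- (s *: y)) wN.
  have {h}/h : `|- (s *: y)| <= eta.
    by apply: le_trans nv _; apply: le_trans k1; rewrite sE mulrAC.
  rewrite /w addrK -scaleNr dotrvZr mulNr opprK -/w ler_norml => /andP[_ h].
  set D := dotrv (grad g w) y in h.
  have hA : (1 - t) * g x <= (1 - t) * (g w - s * D + e * (s * r)).
    rewrite ler_pM2l ?subr_gt0; last by case/andP: t01.
    rewrite -lerBlDl opprB addrA addrAC; apply: le_trans h _.
    by rewrite ler_pM2l// scaleNr.
  have st_ : (1 - t) * s = t * lambda.
    rewrite /s; field; rewrite subr_eq0 gt_eqF//; by case/andP: t01.
  have h2 : (1 - t) * (s * D) = t * (lambda * D) by rewrite mulrA st_ mulrA.
  have h3 : (1 - t) * (e * (s * r)) <= t * d.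
    have -> : (1 - t) * (e * (s * r)) = t * (d * (r / (r + 1))).
      have -> : (1 - t) * (e * (s * r)) = e * r * ((1 - t) * s) by ring.
      by rewrite st_ /e; field; rewrite !gt_eqF.
    by rewrite ler_pM2l// ler_piMr ?(ltW d0)// ler_pdivrMr// mul1r lerDl.
  have h4 : t * (- lambda * D - phi y) <= t * Phi w.
    by rewrite ler_pM2l// -dotrvZl.
  exact: (tangent_weight_arith hA h2 h3 h4).
have psiC : exists B, forall x, box (M + s * r) x -> psi x <= B.
  exists (Cg + t * C) => x xM; apply: lerD.
    by apply: le_trans (ler_norm _) _; apply: gC; exact: box_subset xM.
  by rewrite ler_pM2l// (le_trans (ler_norm _))// PsiC.
have FMp : 0 < FM M by exact: FM0.
have := prekopa_leindler_box t01 l0 r0 cphi cg mpsi psiC admissible FMp P0.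
rewrite -/s -/P -/(FM M); set LL := (X in FM M * (1 + t * X)) => st1.
have st2 := exp_perturbation_le cg mPsi t0 PsiC k2.
rewrite -/(FM (M + s * r)) in st2.
have st3 : \int[L]_(x in box (M + s * r)) (Psi x * expR (g x)) =
    QM (M + s * r) + d * FM (M + s * r).
  have mB : measurable (@box R n (M + s * r)) by exact: measurable_box.
  have i1 := integrableS measurableT mB (@subsetT _ _) gi.
  have i2 := integrableS measurableT mB (@subsetT _ _) Qi.
  have i3 : L.-integrable (box (M + s * r)) (EFin \o (fun x => d * expR (g x))).
    exact: (integrableZl mB d i1).
  rewrite /QM /FM -RintegralZl// -RintegralD//.
  by apply: eq_Rintegral => x _; rewrite /Psi; ring.
rewrite st3 in st2.
have st4 : FM (M + s * r) <= FM M + 2 * t * d.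
  rewrite -lerBlDl -uj1; apply: le_trans hj _.
  by rewrite mulrC ler_wpM2r// ltW.
have st5 := box_mass_le (M + s * r).
rewrite -(ler_pM2l t0).
have st := le_trans st1 st2.
set G := FM (M + s * r) in st st4 st5 *.
have G0 : 0 <= G by rewrite /G; apply: Rintegral_ge0 => x _; exact: expR_ge0.
have st6 : 2 * t ^+ 2 * C ^+ 2 * G <= t * d.
  apply: (@le_trans _ _ (2 * t ^+ 2 * C ^+ 2 * F)).
    by rewrite ler_wpM2l// mulr_ge0 ?sqr_ge0// mulr_ge0 ?sqr_ge0.
  rewrite (_ : 2 * t ^+ 2 * C ^+ 2 * F = t * (t * (2 * C ^+ 2 * F))); last by ring.
  by rewrite ler_pM2l.
have st7 : t * (d * G) <= t * (d * F) by rewrite !ler_pM2l.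
exact: (step_gain_arith st st4 st6 st7).
Qed.

(** Both tails and - ln P are made smaller than d by the choice of the boxes, so
    that the inequality holds up to d times a constant. *)
Lemma entropy_inequality : F * (n%:R * ln lambda + n%:R - ln F) <= Q.
Proof.
set K0 := _ - ln F.
pose A := 4 + 2 * F + `|K0|.
have A0 : 0 < A by rewrite ltr_wpDr// ltr_wpDr// mulr_ge0 ?(ltW F0).
apply/ler_addgt0Pr => e e0.
pose d := e / A.
have d0 : 0 < d by rewrite divr_gt0.
have -> : e = d * A by rewrite /d divfK ?gt_eqF.
have d'0 : 0 < Num.min d (F / 2) by rewrite lt_min d0 divr_gt0.
have [M1 M10 tail1] := Rintegral_box_tail gi d'0.
have [M2 M20 tail2] := Rintegral_box_tail Qi d0.
have ed0 : 0 < 1 - expR (- d).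
  by rewrite subr_gt0 -expR0 ltr_expR oppr_lt0.
have [r r0 /(_ r (lexx _))] := Rintegral_box_tail phii ed0.
rewrite phi1 ler_norml => /andP[_]; rewrite lerD2l lerN2 => Pd.
pose M0 := Num.max M1 M2.
have tF M : M0 <= M -> `|F - FM M| <= Num.min d (F / 2).
  by rewrite ge_max => /andP[h _]; exact: tail1.
have tQ M : M0 <= M -> `|Q - QM M| <= d.
  by rewrite ge_max => /andP[_ h]; exact: tail2.
have tFd M : M0 <= M -> `|F - FM M| <= d.
  by move=> /tF; rewrite le_min => /andP[].
have FM0 M : M0 <= M -> 0 < FM M.
  move=> /tF; rewrite le_min => /andP[_]; rewrite ler_norml => /andP[_ h].
  by move: h F0; lra.
have P0 : 0 < \int[L]_(y in box r) expR (- phi y) by apply: lt_le_trans Pd; exact: expR_gt0.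
have M00 : 0 <= M0 by rewrite le_max M10.
have FMd : F - FM M0 <= d by apply: le_trans (ler_norm _) (tFd _ (lexx _)).
have [M [M' [M0M MM' est]]] := entropy_step d0 r0 M00 FM0 P0 FMd.
have lnP : - d <= ln (\int[L]_(y in box r) expR (- phi y)).
  by rewrite -[leLHS]expRK ler_ln ?posrE ?expR_gt0.
have lnF : ln (FM M) <= ln F by rewrite ler_ln; [exact: box_mass_le|exact: FM0|exact: F0].
have h1 : FM M * (K0 - d) <= QM M' + (3 + F) * d.
  apply: le_trans est; rewrite ler_pM2l ?FM0//.
  exact: log_loss_arith lnP lnF.
have h2 : QM M' <= Q + d.
  by have := tQ M' (le_trans M0M MM'); rewrite distrC ler_distl => /andP[].
have h3 : (F - FM M) * K0 <= d * `|K0|.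
  apply: le_trans (ler_norm _) _; rewrite normrM ler_wpM2r//; exact: tFd.
have h4 : d * FM M <= d * F.
  by apply: ler_wpM2l; [exact: ltW|exact: box_mass_le].
exact: (vanishing_loss_arith h1 h2 h3 h4).
Qed.

End entropy_inequality.

(** * Optimal logarithmic Sobolev inequality *)

Section optimal_log_sobolev.
Context {R : realType} {n : nat}.
Local Notation L := (@lebesgue_rV R n).
Implicit Types (f g h phi psi : 'rV[R]_n -> R).

(** On the unit box, which has positive volume, e^g is bounded below. *)
Lemma Rintegral_expR_gt0 g : continuous g ->
  L.-integrable setT (EFin \o (expR \o g)) -> 0 < \int[L]_x expR (g x).
Proof.
move=> cg gi; have [C C0 gC] := continuous_box_bound 1 cg.
have v0 : 0 < fine (L (@box R n 1)).
  apply: fine_gt0; rewrite box_volume_lty andbT.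
  pose I : set (measurableTypeR R) := `[- 1, 1]%classic.
  rewrite /box (lebesgue_rV_box (A := fun=> I)); last by move=> _; exact: measurable_itv.
  elim/big_ind : _ => [|x y x0 y0|i _]; first by rewrite lte01.
    exact: mule_gt0.
  rewrite /= lebesgue_measure_itv/= lte_fin.
  have N1 : (- 1 : R) < 1 by lra.
  by rewrite N1 -EFinB lte_fin subr_gt0.
apply: lt_le_trans (box_mass_le gi 1).
apply: (@lt_le_trans _ _ (\int[L]_(x in @box R n 1) expR (- C))).
  rewrite Rintegral_cst; last exact: measurable_box.
  by rewrite mulr_gt0// expR_gt0.
have mB : measurable (@box R n 1) by exact: measurable_box.
apply: le_Rintegral => //.
- by apply: continuous_box_integrable => x; exact: cst_continuous.
- exact: integrableS gi.
- move=> x xB; rewrite ler_expR; have := gC x xB; rewrite ler_norml.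
  by case/andP.
Qed.

Lemma integrable_expR_opp phi : continuous phi ->
  (\int[L]_x (expR (- phi x))%:E = 1)%E ->
  L.-integrable setT (EFin \o (fun x => expR (- phi x))).
Proof.
move=> cphi phi1; apply/integrableP; split.
  apply/measurable_EFinP; apply: measurableT_comp => //.
  by apply: continuous_measurable_rV => x; apply: continuousN; exact: cphi.
under eq_integral do rewrite /= ger0_norm ?expR_ge0//.
by rewrite phi1 ltry.
Qed.

Lemma ln_expR_div (x F : R) : 0 < F -> ln (expR x / F) = x - ln F.
Proof. by move=> F0; rewrite ln_div ?posrE ?expR_gt0// expRK. Qed.

(** The real inequality for Phi = phi^*(- lambda grad g). Superlinearity makes
    phi^* finite and locally bounded; Phi is measurable because the product of
    Phi and e^g is integrable, hence measurable. The logarithm of the mass F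
    of e^g occurs in the entropy and in the real inequality alike, and cancels. *)
Lemma optimal_log_sobolev phi lambda g : continuous phi -> superlinear phi ->
  (\int[L]_x (expR (- phi x))%:E = 1)%E ->
  0 < lambda -> C1 g -> integrals_exist phi lambda g ->
  (ent (expR \o g) <=
        (- (n%:R * ln (lambda * expR 1)))%:E
          * \int[L]_x (expR (g x))%:E
        + \int[L]_x fenchel_integrand phi lambda g x)%E.
Proof.
move=> cphi sphi phi1 l0 C1g [gi enti feni].
have cg := continuous_C1 C1g.
have mg := continuous_measurable_rV cg.
pose F := \int[L]_x expR (g x).
have F0 : 0 < F := Rintegral_expR_gt0 cg gi.
pose Phi x := fine (fenchel phi (- lambda *: grad g x)).
have fenE x : fenchel_integrand phi lambda g x = (Phi x * expR (g x))%:E.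
  by rewrite /fenchel_integrand EFinM /Phi fineK// fenchel_fin_num.
have feni' : L.-integrable setT (EFin \o (fun x => Phi x * expR (g x))).
  by apply: eq_integrable feni => // x _ /=; rewrite fenE.
have entE x : ent_integrand (expR \o g) x = expR (g x) * (g x - ln F).
  by rewrite /ent_integrand /= ln_expR_div.
have enti' : L.-integrable setT (EFin \o (fun x => expR (g x) * (g x - ln F))).
  by apply: eq_integrable enti => // x _ /=; rewrite entE.
have mPhi : measurable_fun setT Phi.
  rewrite (_ : Phi = (fun x => (Phi x * expR (g x)) * expR (- g x))).
    apply: measurable_funM; first by apply/measurable_EFinP; case/integrableP: feni'.
    by apply: measurableT_comp => //; exact: measurable_funN.
  by apply/funext => x; rewrite -mulrA -expRD subrr expR0 mulr1.
have PhiB K : exists B, forall x, box K x -> `|Phi x| <= B.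
  by apply: fenchel_bound_box => //; exact: C1g.2.
have Phige w y : dotrv (- lambda *: grad g w) y - phi y <= Phi w.
  by rewrite -lee_fin /Phi fineK ?fenchel_fin_num//; exact: fenchel_ge.
have phii := integrable_expR_opp cphi phi1.
have phi1' : \int[L]_x expR (- phi x) = 1 by rewrite /Rintegral phi1.
have lnFi : L.-integrable setT (EFin \o (fun x => ln F * expR (g x))).
  exact: (integrableZl measurableT (ln F) gi).
have QE x : (Phi x - g x) * expR (g x) =
   Phi x * expR (g x) - expR (g x) * (g x - ln F) - ln F * expR (g x) by ring.
have i1 : L.-integrable setT
    (EFin \o (fun x => Phi x * expR (g x) - expR (g x) * (g x - ln F))).
  exact: (integrableB measurableT feni' enti').
have Qi : L.-integrable setT (EFin \o (fun x => (Phi x - g x) * expR (g x))).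
  apply: eq_integrable (integrableB measurableT i1 lnFi) => // x _ /=.
  by rewrite QE.
have main := entropy_inequality l0 cphi C1g mPhi PhiB Phige phii phi1' gi Qi F0.
have QEint : \int[L]_x ((Phi x - g x) * expR (g x)) =
    \int[L]_x (Phi x * expR (g x)) - \int[L]_x (expR (g x) * (g x - ln F)) - ln F * F.
  rewrite -RintegralZl// -RintegralB// -RintegralB//.
  by apply: eq_Rintegral => x _; exact: QE.
rewrite QEint -/F in main.
have -> : ent (expR \o g) = (\int[L]_x (expR (g x) * (g x - ln F)))%:E.
  rewrite /Rintegral fineK; last exact: integrable_fin_num enti'.
  by apply: eq_integral => x _; rewrite entE.
have -> : (\int[L]_x (expR (g x))%:E)%E = F%:E.
  by rewrite /F /Rintegral fineK//; exact: integrable_fin_num gi.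
have -> : (\int[L]_x fenchel_integrand phi lambda g x)%E = (\int[L]_x (Phi x * expR (g x)))%:E.
  rewrite /Rintegral fineK; last exact: integrable_fin_num feni'.
  by apply: eq_integral => x _; rewrite fenE.
rewrite -EFinM -EFinD lee_fin lnM ?posrE ?expR_gt0// expRK.
by move: main; lra.
Qed.

End optimal_log_sobolev.

(** * Translations and reflections of functions *)

Section translation.
Context {R : realType} {n : nat}.
Local Notation L := (@lebesgue_rV R n).
Implicit Types (f g phi : 'rV[R]_n -> R) (c x z : 'rV[R]_n).

Lemma measurable_shift c : measurable_fun setT (fun x : 'rV[R]_n => x - c).
Proof.
rewrite (_ : (fun x => _) = (fun x => 1 *: x + - c)); first exact: measurable_rV_affine.
by apply/funext => x; rewrite scale1r.
Qed.

Lemma ge0_integral_shift (f : 'rV[R]_n -> \bar R) c :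
  measurable_fun setT f -> (forall x, 0 <= f x)%E ->
  (\int[L]_x f (x - c)%R = \int[L]_x f x)%E.
Proof.
move=> mf f0; have := ge0_integral_rV_affine (- c) ltr01 mf f0.
rewrite invr1 expr1n mul1e => <-.
by apply: eq_integral => x _; rewrite scale1r.
Qed.

(** The integral is by definition the difference of those of the positive and
    negative parts, which are translated separately. *)
Lemma integral_shift (f : 'rV[R]_n -> \bar R) c : measurable_fun setT f ->
  (\int[L]_x f (x - c)%R = \int[L]_x f x)%E.
Proof.
move=> mf; rewrite integralE [RHS]integralE; congr (_ - _)%E.
- rewrite -(ge0_integral_shift c (f := f^\+%E))//.
  by apply: eq_integral => x _; rewrite !funeposE.
  by apply: measurable_funepos.
- rewrite -(ge0_integral_shift c (f := f^\-%E))//.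
  by apply: eq_integral => x _; rewrite !funenegE.
  by apply: measurable_funeneg.
Qed.

Lemma integrable_shift (f : 'rV[R]_n -> \bar R) c :
  L.-integrable setT f -> L.-integrable setT (fun x => f (x - c)).
Proof.
move=> /integrableP[mf fi]; apply/integrableP; split.
  exact: measurableT_comp mf (measurable_shift c).
rewrite (integral_shift (f := abse \o f))//.
exact: measurableT_comp.
Qed.

Lemma grad_shift f c x : grad (fun y => f (y - c)) x = grad f (x - c).
Proof.
apply/rowP => i; rewrite !mxE /derive.
rewrite (_ : (fun h : R => _) = (fun h : R =>
  h^-1 *: ((f \o shift (x - c)) (h *: delta_mx ord0 i) - f (x - c))))//.
by apply/funext => h; rewrite /= addrA.
Qed.

Lemma grad_opp f x : differentiable f x -> grad (fun y => - f y) x = - grad f x.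
Proof.
move=> df; apply/rowP => i; rewrite !mxE.
by apply: deriveN; exact: diff_derivable.
Qed.

Lemma C1_opp f : C1 f -> C1 (fun x => - f x).
Proof.
move=> [df cf]; split => x; first exact: differentiableN.
rewrite (_ : grad _ = (fun x => - grad f x)); last first.
  by apply/funext => y; exact: grad_opp.
by apply: continuousN; exact: cf.
Qed.

Lemma ent_shift f c : measurable_fun setT f ->
  ent (fun x => f (x - c)) = ent f /\
  (forall x, ent_integrand (fun x => f (x - c)) x = ent_integrand f (x - c)).
Proof.
move=> mf.
have E x : ent_integrand (fun x => f (x - c)) x = ent_integrand f (x - c).
  rewrite /ent_integrand (integral_shift (f := EFin \o f))//.
  exact/measurable_EFinP.
split; last exact: E.
rewrite /ent.
under eq_integral do rewrite E.
rewrite (integral_shift (f := EFin \o ent_integrand f))//.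
apply/measurable_EFinP; apply: measurable_funM => //.
apply: measurableT_comp; first exact: measurable_ln.
exact: measurable_funM.
Qed.

End translation.

(** * The extremal function *)

Section equality_case.
Context {R : realType} {n : nat}.
Local Notation L := (@lebesgue_rV R n).
Implicit Types (f g phi : 'rV[R]_n -> R) (c x z : 'rV[R]_n).

(** Convexity bounds phi (x + t v) - phi x by t (phi z - phi x) where v = z - x, and
    the first-order expansion bounds it from below by t (grad phi(x) . v) up to
    o(t). *)
Lemma convex_tangent phi x z : C1 phi -> strictly_convex phi ->
  phi x + dotrv (grad phi x) (z - x) <= phi z.
Proof.
move=> C1phi cphi; have [->|zx] := eqVneq z x.
  by rewrite subrr /dotrv big1 ?addr0// => i _; rewrite [X in _ * X]mxE mulr0.
pose v := z - x.
have bx : box `|x| x by move=> i; rewrite /= in_itv/= -ler_norml coord_le_norm.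
apply/ler_addgt0Pr => e e0.
have v1 : 0 < `|v| + 1 by rewrite ltr_wpDl.
have e1 : 0 < e / (`|v| + 1) by rewrite divr_gt0.
have [d d0 taylor] := uniform_taylor `|x| C1phi e1.
(* Adding 1 to the norm avoids a division by zero. *)
pose t := Num.min (1 / 2) (d / (`|v| + 1)).
have t0 : 0 < t by rewrite lt_min !divr_gt0.
have t1 : t < 1 by rewrite gt_min; apply/orP; left; lra.
have tv : `|t *: v| <= d.
  rewrite normrZ gtr0_norm//; apply: (@le_trans _ _ (d / (`|v| + 1) * `|v|)).
    by rewrite ler_wpM2r// ge_min lexx orbT.
  by rewrite mulrAC ler_pdivrMr// ler_wpM2l ?(ltW d0)// lerDl.
have := taylor x (t *: v) bx tv; rewrite dotrvZr ler_norml => /andP[h _].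
have cv : phi (x + t *: v) <= t * phi z + (1 - t) * phi x.
  have -> : x + t *: v = t *: z + (1 - t) *: x.
    by rewrite /v scalerBr scalerBl scale1r addrCA.
  by apply: ltW; apply: cphi => //; rewrite t0.
have h2 : e / (`|v| + 1) * `|t *: v| <= t * e.
  rewrite normrZ gtr0_norm// mulrCA ler_pM2l// mulrAC ler_pdivrMr//.
  by rewrite ler_wpM2l ?(ltW e0)// lerDl.
rewrite -(ler_pM2l t0) -/v.
by move: h cv h2; lra.
Qed.

(** Equality case of Young's inequality: the supremum is reached at z = x because
    phi lies above its tangent at x. *)
Lemma fenchel_grad phi x : C1 phi -> strictly_convex phi ->
  fenchel phi (grad phi x) = (dotrv (grad phi x) x - phi x)%:E.
Proof.
move=> C1phi cphi; apply/eqP; rewrite eq_le fenchel_ge andbT.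
apply: ge_ereal_sup => _ [z _ <-]; rewrite lee_fin.
have := convex_tangent x z C1phi cphi.
have -> : dotrv (grad phi x) (z - x) = dotrv (grad phi x) z - dotrv (grad phi x) x.
  by rewrite /dotrv -sumrB; apply: eq_bigr => i _; rewrite !mxE mulrBr.
lra.
Qed.

End equality_case.

Section radial_derivative.
Context {R : realType} {n : nat}.
Local Notation L := (@lebesgue_rV R n).
Context {phi : 'rV[R]_n -> R} (C1phi : C1 phi) (convphi : strictly_convex phi)
  (supphi : superlinear phi) (phi1 : (\int[L]_x (expR (- phi x))%:E = 1)%E).

Let cphi : continuous phi := continuous_C1 C1phi.
Let mphi : measurable_fun setT phi := continuous_measurable_rV cphi.
Let phii := integrable_expR_opp cphi phi1.

Lemma convex_scale_le (r : R) (z : 'rV[R]_n) : 0 < r < 1 ->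
  phi (r *: z) <= r * phi z + (1 - r) * phi 0.
Proof.
move=> r01; have [->|z0] := eqVneq z 0.
  by rewrite scaler0 -mulrDl subrKC mul1r.
have := convphi z0 r01; rewrite scaler0 addr0.
exact: ltW.
Qed.

Lemma measurable_phi_scale (r : R) : measurable_fun setT (fun x : 'rV[R]_n => phi (r *: x)).
Proof.
rewrite (_ : (fun x => _) = (fun x => phi (r *: x + 0))).
  exact: measurableT_comp mphi (measurable_rV_affine _ _).
by apply/funext => x; rewrite addr0.
Qed.

Lemma integral_expR_opp_scale (r : R) : 0 < r ->
  (\int[L]_x (expR (- phi (r *: x)))%:E = (r^-1 ^+ n)%:E)%E.
Proof.
move=> r0; pose f x := (expR (- phi x))%:E.
have mf : measurable_fun setT f.
  apply/measurable_EFinP; apply: measurableT_comp => //; exact: measurable_funN.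
have f0 x : (0 <= f x)%E by rewrite lee_fin expR_ge0.
have := ge0_integral_rV_affine 0 r0 mf f0; rewrite phi1 mule1 => <-.
by apply: eq_integral => x _; rewrite addr0.
Qed.

(** By convexity phi(x) / 2 >= phi(x / 2) - phi(0) / 2, so e^(-phi/2) is dominated
    by a multiple of e^(-phi(x / 2)), whose integral is 2^n. *)
Lemma integrable_expR_opp_half :
  L.-integrable setT (EFin \o (fun x => expR (- (phi x / 2)))).
Proof.
apply/integrableP; split.
  apply/measurable_EFinP; apply: measurableT_comp => //; apply: measurable_funN.
  exact: measurable_funM.
apply: (@le_lt_trans _ _ (\int[L]_x ((expR (phi 0 / 2))%:E * (expR (- phi (2^-1 *: x)))%:E))%E).
  apply: ge0_le_integral => //.
  - apply: measurableT_comp => //; apply/measurable_EFinP; apply: measurableT_comp => //.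
    apply: measurable_funN; exact: measurable_funM.
  - apply: measurable_funeM; apply/measurable_EFinP; apply: measurableT_comp => //.
    by apply: measurable_funN; exact: measurable_phi_scale.
  - move=> x _; rewrite /= ger0_norm ?expR_ge0// -EFinM -expRD lee_fin ler_expR.
    have h : 0 < (2^-1 : R) < 1 by lra.
    by have := convex_scale_le x h; lra.
rewrite ge0_integralZl//.
- by rewrite integral_expR_opp_scale ?invr_gt0// -EFinM ltry.
- apply/measurable_EFinP; apply: measurableT_comp => //.
  by apply: measurable_funN; exact: measurable_phi_scale.
Qed.

(** With phi + B >= 0, the bound u e^(-u/2) <= 2 for u = phi + B shows that
    |phi| e^-phi is dominated by e^(-phi/2) and e^-phi. *)
Lemma integrable_mul_expR_opp :
  L.-integrable setT (EFin \o (fun x => phi x * expR (- phi x))).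
Proof.
have [B hB] := superlinear_growth 0 cphi supphi.
have phiB x : - phi x <= B by have := hB x; rewrite mul0r sub0r.
have i1 : L.-integrable setT (EFin \o (fun x =>
    2 * expR (B / 2) * expR (- (phi x / 2)))).
  exact: (integrableZl measurableT (2 * expR (B / 2)) integrable_expR_opp_half).
have i2 : L.-integrable setT (EFin \o (fun x => `|B| * expR (- phi x))).
  exact: (integrableZl measurableT `|B| phii).
apply: (le_integrable measurableT _ _ (integrableD measurableT i1 i2)).
  apply/measurable_EFinP; apply: measurable_funM => //.
  by apply: measurableT_comp => //; exact: measurable_funN.
move=> x _; rewrite /= lee_fin normrM (ger0_norm (expR_ge0 _)).
apply: le_trans (ler_norm _).
have u0 : 0 <= phi x + B by have := phiB x; lra.
apply: (@le_trans _ _ ((phi x + B + `|B|) * expR (- phi x))).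
  rewrite ler_wpM2r ?expR_ge0//.
  have -> : phi x = (phi x + B) - B by ring.
  apply: le_trans (ler_normB _ _) _; rewrite (ger0_norm u0).
  by rewrite addrK.
rewrite mulrDl lerD2r.
have -> : expR (- phi x) = expR (- (phi x / 2)) * expR (- ((phi x + B) / 2)) * expR (B / 2).
  by rewrite -!expRD; congr expR; field.
set a := expR (- (phi x / 2)); set b := expR (B / 2).
have h : (phi x + B) * expR (- ((phi x + B) / 2)) <= 2.
  rewrite expRN ler_pdivrMr ?expR_gt0//.
  by have := expR_ge1Dx ((phi x + B) / 2); lra.
have -> : (phi x + B) * (a * expR (- ((phi x + B) / 2)) * b) =
  ((phi x + B) * expR (- ((phi x + B) / 2))) * (b * a) by ring.
rewrite -[leRHS]mulrA ler_wpM2r// mulr_ge0 ?expR_ge0//.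
Qed.

Let D x := dotrv (grad phi x) x.

Lemma measurable_radial : measurable_fun setT D.
Proof.
rewrite /D /dotrv; apply: measurable_sum => i.
apply: measurable_funM; last exact: measurable_rV_coord.
by apply: continuous_measurable_rV; apply: continuous_grad_coord; exact: C1phi.2.
Qed.

Lemma radial_ge x : phi x - phi 0 <= D x.
Proof.
have := convex_tangent x 0 C1phi convphi.
rewrite sub0r (_ : dotrv _ _ = - D x); first lra.
by rewrite /D /dotrv -sumrN; apply: eq_bigr => i _; rewrite [X in _ * X]mxE mulrN.
Qed.

(** The quotients are those of the derivative of r |-> phi (r x) at r = 1, along
    r = 1 - 1 / (k + 2). *)
Lemma radial_quotient_cvg (x : 'rV[R]_n) :
  (fun k : nat => (phi x - phi ((1 - k.+2%:R^-1) *: x)) * k.+2%:R) @ \oo --> D x.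
Proof.
apply/cvgrPdist_le => e e0.
have bx : box `|x| x by move=> i; rewrite /= in_itv/= -ler_norml coord_le_norm.
have v1 : 0 < `|x| + 1 by rewrite ltr_wpDl.
have e1 : 0 < e / (`|x| + 1) by rewrite divr_gt0.
have [d d0 taylor] := uniform_taylor `|x| C1phi e1.
have dx : 0 < d / (`|x| + 1) by rewrite divr_gt0.
near=> k.
set s := k.+2%:R^-1.
have s0 : 0 < s by rewrite invr_gt0 ltr0n.
have -> : k.+2%:R = s^-1 by rewrite /s invrK.
have sd : s <= d / (`|x| + 1).
  apply: (@le_trans _ _ k.+1%:R^-1).
    by rewrite /s lef_pV2 ?posrE ?ltr0n// ler_nat.
  near: k; have := near_infty_natSinv_lt (PosNum dx).
  by apply: filterS => k /ltW.
have nv : `|- s *: x| = s * `|x| by rewrite normrZ normrN gtr0_norm.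
have vd : `|- s *: x| <= d.
  rewrite nv; apply: (@le_trans _ _ (d / (`|x| + 1) * `|x|)).
    by rewrite ler_wpM2r.
  by rewrite mulrAC ler_pdivrMr// ler_wpM2l ?(ltW d0)// lerDl.
have := taylor x (- s *: x) bx vd.
rewrite nv dotrvZr -/(D x) (_ : x + - s *: x = (1 - s) *: x); last first.
  by rewrite scalerBl scale1r scaleNr.
move=> h.
have -> : D x - (phi x - phi ((1 - s) *: x)) * s^-1 =
   (phi ((1 - s) *: x) - phi x - - s * D x) / s by field; rewrite gt_eqF.
rewrite normrM normfV (gtr0_norm s0) ler_pdivrMr//; apply: le_trans h _.
rewrite mulrCA mulrC ler_pM2r// mulrAC ler_pdivrMr// ler_wpM2l ?(ltW e0)//.
by rewrite lerDl.
Unshelve. all: by end_near.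
Qed.

(** With r = 1 - 1 / (k + 2) one has 1 / r = 1 + u for u = 1 / (k + 1), so this
    bounds the difference quotient of r^-n at 1 by a sequence with limit n. *)
Lemma geometric_quotient_le (k : nat) :
  ((1 - k.+2%:R^-1)^-1 ^+ n - 1) * k.+2%:R <= n%:R * (1 + k.+1%:R^-1) ^+ n.+1 :> R.
Proof.
pose u : R := k.+1%:R^-1.
have k0 : (0 : R) < k.+1%:R by rewrite ltr0n.
have u0 : 0 < u by rewrite invr_gt0.
have kE : k.+2%:R = k.+1%:R + 1 :> R by rewrite -natr1.
have k2n : k.+1%:R + 1 != 0 :> R by rewrite -kE gt_eqF// ltr0n.
have E1 : (1 - k.+2%:R^-1)^-1 = 1 + u :> R.
  rewrite kE (_ : 1 - _ = k.+1%:R / (k.+1%:R + 1)); last by field.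
  by rewrite invf_div mulrDl divff ?gt_eqF// mul1r.
have E2 : k.+2%:R = (1 + u) / u :> R.
  by rewrite kE /u invrK mulrDl mul1r mulVf ?gt_eqF// addrC.
rewrite E1 E2 -/u.
have h m : (1 + u) ^+ m - 1 <= m%:R * u * (1 + u) ^+ m.
  elim: m => [|m IH]; first by rewrite expr0 subrr mul0r mul0r.
  have p1 : 1 <= (1 + u) ^+ m by rewrite exprn_ege1// lerDl ltW.
  rewrite exprS -natr1.
  move: IH p1; set q := (1 + u) ^+ m => IH p1.
  have u0' : 0 <= u by exact: ltW.
  have q0 : 0 <= q by exact: le_trans ler01 p1.
  have q1 : 0 <= u * (m%:R * u * q) by rewrite mulr_ge0// mulr_ge0// mulr_ge0.
  have q2 : 0 <= u * (u * q) by rewrite mulr_ge0// mulr_ge0.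
  lra.
rewrite mulrA ler_pdivrMr// exprSr mulrA mulrAC ler_pM2r ?addr_gt0//.
by rewrite mulrAC.
Qed.

End radial_derivative.

Lemma le_limn_einf {R : realType} (u v : (\bar R)^nat) :
  (forall k, u k <= v k)%E -> (limn_einf u <= limn_einf v)%E.
Proof.
move=> uv; rewrite !limn_einf_lim; apply: lee_lim; [exact: is_cvg_einfs..|].
apply: nearW => k; apply: le_ereal_inf_tmp => _ [m km <-].
by apply: le_trans (uv m); apply: ereal_inf_lbound; exists m.
Qed.

Section extremal.
Context {R : realType} {n : nat}.
Local Notation L := (@lebesgue_rV R n).
Context {phi : 'rV[R]_n -> R} (C1phi : C1 phi) (convphi : strictly_convex phi)
  (supphi : superlinear phi) (phi1 : (\int[L]_x (expR (- phi x))%:E = 1)%E).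

Let cphi : continuous phi := continuous_C1 C1phi.
Let mphi : measurable_fun setT phi := continuous_measurable_rV cphi.
Let phii := integrable_expR_opp cphi phi1.
Let D x := dotrv (grad phi x) x.
Let f x := expR (- phi x).
Let mf : measurable_fun setT f.
Proof. by apply: measurableT_comp => //; exact: measurable_funN. Qed.
Let mD : measurable_fun setT D := measurable_radial C1phi.

Let lowi : L.-integrable setT (EFin \o (fun x => (phi x - phi 0) * f x)).
Proof.
have i0 : L.-integrable setT (EFin \o (fun x => phi 0 * f x)).
  exact: (integrableZl measurableT (phi 0) phii).
apply: eq_integrable (integrableB measurableT
  (integrable_mul_expR_opp C1phi convphi supphi phi1) i0) => // x _ /=.
by rewrite mulrBl EFinB.
Qed.
Let E' := \int[L]_x ((phi x - phi 0) * f x).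

Let r (k : nat) : R := 1 - k.+2%:R^-1.
Let q (k : nat) x := f x * ((phi x - phi (r k *: x)) * k.+2%:R - (phi x - phi 0)).

Let r01 k : 0 < r k < 1.
Proof.
have k2 : (0 : R) < k.+2%:R by rewrite ltr0n.
by rewrite /r subr_gt0 invf_lt1// ltr1n/= gtrDl oppr_lt0 invr_gt0.
Qed.

Let q_ge0 k x : 0 <= q k x.
Proof.
rewrite /q mulr_ge0 ?expR_ge0// subr_ge0.
have k2 : (0 : R) < k.+2%:R by rewrite ltr0n.
rewrite -ler_pdivrMr//.
have := convex_scale_le convphi x (r01 k).
have -> : (phi x - phi 0) / k.+2%:R = (1 - r k) * (phi x - phi 0).
  by rewrite /r opprB addrCA subrr addr0 mulrC.
lra.
Qed.

Let mq k : measurable_fun setT (q k).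
Proof.
apply: measurable_funM => //; apply: measurable_funB.
  apply: measurable_funM => //; apply: measurable_funB => //.
  exact: measurable_phi_scale.
exact: measurable_funB.
Qed.

Let scalei k : L.-integrable setT (EFin \o (fun x => f (r k *: x))).
Proof.
have /andP[r0 _] := r01 k.
apply/integrableP; split.
  apply/measurable_EFinP; rewrite /f.
  apply: (measurableT_comp (@measurable_expR R)) => //; apply: measurable_funN.
  exact: measurable_phi_scale.
under eq_integral do rewrite /= ger0_norm ?expR_ge0//.
by rewrite integral_expR_opp_scale// ltry.
Qed.

Let integral_q_le k : (\int[L]_x (q k x)%:E <=
  (n%:R * (1 + k.+1%:R^-1) ^+ n.+1 - E')%:E)%E.
Proof.
have /andP[r0 _] := r01 k.
have k2 : (0 : R) < k.+2%:R by rewrite ltr0n.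
pose b x := (f (r k *: x) - f x) * k.+2%:R - (phi x - phi 0) * f x.
have qb x : q k x <= b x.
  rewrite /q /b mulrBr [X in _ - X]mulrC lerD2r mulrA ler_pM2r//.
  have -> : f (r k *: x) = f x * expR (phi x - phi (r k *: x)).
    by rewrite /f -expRD; congr expR; ring.
  rewrite -[X in _ <= _ - X]mulr1 -mulrBr ler_pM2l ?expR_gt0//.
  by rewrite lerBrDl expR_ge1Dx.
have i1 : L.-integrable setT (EFin \o (fun x => f (r k *: x) - f x)).
  exact: (integrableB measurableT (scalei k) phii).
have i2 : L.-integrable setT (EFin \o (fun x => (f (r k *: x) - f x) * k.+2%:R)).
  exact: (integrableZr measurableT k.+2%:R i1).
have i3 : L.-integrable setT (EFin \o b) by exact: (integrableB measurableT i2 lowi).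
apply: (@le_trans _ _ (\int[L]_x (b x)%:E)%E).
  apply: ge0_le_integral => //.
  - by move=> x _; rewrite lee_fin.
  - exact/measurable_EFinP.
  - by case/integrableP: i3.
  - by move=> x _; rewrite lee_fin.
rewrite -(fineK (integrable_fin_num measurableT i3)) lee_fin -/(Rintegral _ _ _).
rewrite [leLHS]RintegralB// -/E' lerD2r RintegralZr// RintegralB//.
rewrite [X in (X - _) * _]/Rintegral integral_expR_opp_scale//=.
rewrite [X in (_ - X) * _]/Rintegral phi1/=.
exact: geometric_quotient_le.
Qed.

Let G x := f x * (D x - (phi x - phi 0)).

Let G_ge0 x : 0 <= G x.
Proof. by rewrite mulr_ge0 ?expR_ge0// subr_ge0 radial_ge. Qed.

Let integral_G_le : (\int[L]_x (G x)%:E <= (n%:R - E')%:E)%E.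
Proof.
have := @fatou _ _ _ L setT measurableT (fun k x => (q k x)%:E)
  (fun k => (measurable_EFinP _ _).2 (mq k)) (fun k x _ => q_ge0 k x).
have -> : (\int[L]_x limn_einf (fun k => (q k x)%:E) = \int[L]_x (G x)%:E)%E.
  apply: eq_integral => x _.
  suff h : (fun k => (q k x)%:E) @ \oo --> (G x)%:E by rewrite (cvg_limn_einf_sup h).
  apply: cvg_EFin; first exact: nearW.
  apply: cvgM; first exact: cvg_cst.
  apply: cvgB; last exact: cvg_cst.
  exact: radial_quotient_cvg.
move=> /le_trans; apply; apply: le_trans (le_limn_einf integral_q_le) _.
suff h : (fun k => (n%:R * (1 + k.+1%:R^-1) ^+ n.+1 - E')%:E) @ \oo --> (n%:R - E')%:E.
  by rewrite (cvg_limn_einf_sup h).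
apply: cvg_EFin; first exact: nearW.
apply: cvgB; last exact: cvg_cst.
rewrite -[X in _ --> X]mulr1; apply: cvgM; first exact: cvg_cst.
have h : (fun k : nat => 1 + k.+1%:R^-1 : R) @ \oo --> (1 : R).
  rewrite -[X in _ --> X]addr0; apply: cvgD; first exact: cvg_cst.
  exact: cvg_harmonic.
have := @cvg_comp _ _ _ _ (fun x : R => x ^+ n.+1) _ _ _ h (@exprn_continuous R n.+1 1).
by rewrite expr1n.
Qed.

Let Gi : L.-integrable setT (EFin \o G).
Proof.
apply/integrableP; split.
  apply/measurable_EFinP; apply: measurable_funM => //; apply: measurable_funB => //.
  exact: measurable_funB.
under eq_integral do rewrite /= ger0_norm ?G_ge0//.
by rewrite (le_lt_trans integral_G_le)// ltry.
Qed.

Lemma radial_integrable : L.-integrable setT (EFin \o (fun x => D x * f x)).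
Proof.
apply: eq_integrable (integrableD measurableT Gi lowi) => // x _ /=.
by rewrite /G -EFinD; congr (_%:E); ring.
Qed.

(** Fatou's lemma for the quotients of [radial_quotient_cvg], weighted by e^-phi
    and made nonnegative by the subtraction of their lower bound phi - phi 0. By
    e^a - e^b >= e^b (a - b) they are dominated by the quotients of e^(-phi(r x)),
    whose integrals are explicit. *)
Lemma radial_integral_le : \int[L]_x (D x * f x) <= n%:R.
Proof.
have -> : \int[L]_x (D x * f x) = \int[L]_x G x + E'.
  rewrite -RintegralD//; apply: eq_Rintegral => x _; rewrite /G; ring.
rewrite -lerBrDr -lee_fin; apply: le_trans integral_G_le.
by rewrite /Rintegral fineK//; exact: integrable_fin_num Gi.
Qed.

Let g0 x := - phi x.

Let gradg0 x : - 1 *: grad g0 x = grad phi x.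
Proof.
by rewrite /g0 grad_opp ?scaleN1r ?opprK//; exact: C1phi.1.
Qed.

Let fenE x : fenchel_integrand phi 1 g0 x = ((D x - phi x) * f x)%:E.
Proof. by rewrite /fenchel_integrand gradg0 fenchel_grad// EFinM. Qed.

Let entE x : ent_integrand (expR \o g0) x = - (phi x * f x).
Proof. by rewrite /ent_integrand/= phi1/= divr1 expRK mulrN mulrC. Qed.

Let phifi := integrable_mul_expR_opp C1phi convphi supphi phi1.

Let feni : L.-integrable setT (EFin \o (fun x => (D x - phi x) * f x)).
Proof.
apply: eq_integrable (integrableB measurableT radial_integrable phifi) => // x _ /=.
by rewrite -EFinB mulrBl.
Qed.

Lemma extremal_integrals_exist : integrals_exist phi 1 (fun x => - phi x).
Proof.
split; first exact: phii.
- apply: eq_integrable (integrableN phifi) => // x _ /=.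
  by rewrite -/g0 entE EFinN.
- by apply: eq_integrable feni => // x _ /=; rewrite -/g0 fenE.
Qed.

(** One inequality is [optimal_log_sobolev]; the other is
    [radial_integral_le]. *)
Lemma extremal_equality :
  (ent (expR \o (fun x => - phi x)%R) =
        (- (n%:R * ln (1 * expR 1)))%:E
          * \int[L]_x (expR (- phi x))%:E
        + \int[L]_x fenchel_integrand phi 1 (fun x => - phi x)%R x)%E.
Proof.
apply/eqP; rewrite eq_le; apply/andP; split.
  exact: (optimal_log_sobolev cphi supphi phi1 ltr01 (C1_opp C1phi)
    extremal_integrals_exist).
rewrite phi1 mule1 mul1r expRK mulr1 -/g0.
have -> : (\int[L]_x fenchel_integrand phi 1 g0 x =
    (\int[L]_x (D x * f x) - \int[L]_x (phi x * f x))%:E)%E.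
  rewrite -RintegralB//; last exact: radial_integrable.
  rewrite /Rintegral.
  under [in RHS]eq_integral do rewrite -mulrBl.
  rewrite fineK; last exact: integrable_fin_num feni.
  by apply: eq_integral => x _; rewrite fenE.
have -> : ent (expR \o g0) = (- \int[L]_x (phi x * f x))%:E.
  rewrite /ent; under eq_integral do rewrite entE EFinN.
  rewrite integralN/=; last first.
    by apply: integrable_add_def.
  by rewrite EFinN /Rintegral fineK//; exact: integrable_fin_num phifi.
rewrite -EFinD lee_fin.
by have := radial_integral_le; lra.
Qed.

End extremal.

Theorem theorem3p1 (R : realType) (n : nat) (phi : 'rV[R]_n -> R)
    (phi_C1 : C1 phi) (phi_convex : strictly_convex phi)
    (phi_superlinear : superlinear phi)
    (phi_mass1 : (\int[lebesgue_rV n]_x (expR (- phi x))%:E = 1)%E) :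
  (forall (lambda : R) (g : 'rV[R]_n -> R),
     0 < lambda -> C1 g -> integrals_exist phi lambda g ->
     (ent (expR \o g) <=
        (- (n%:R * ln (lambda * expR 1)))%:E
          * \int[lebesgue_rV n]_x (expR (g x))%:E
        + \int[lebesgue_rV n]_x fenchel_integrand phi lambda g x)%E) /\
  (forall xbar : 'rV[R]_n,
     let g := fun x => - phi (x - xbar) in
     integrals_exist phi 1 g /\
     (ent (expR \o g) =
        (- (n%:R * ln (1 * expR 1)))%:E
          * \int[lebesgue_rV n]_x (expR (g x))%:E
        + \int[lebesgue_rV n]_x fenchel_integrand phi 1 g x)%E).
Proof.
have cphi := continuous_C1 phi_C1.
split=> [lambda g l0 C1g ints|xbar g]; first exact: optimal_log_sobolev.
have [i1 i2 i3] := extremal_integrals_exist phi_C1 phi_convex phi_superlinear phi_mass1.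
pose f := expR \o (fun x => - phi x).
have mf : measurable_fun setT f.
  apply: measurableT_comp => //; apply: measurable_funN.
  exact: continuous_measurable_rV.
have [entE entxE] := ent_shift xbar mf.
have fenE x : fenchel_integrand phi 1 g x =
    fenchel_integrand phi 1 (fun x => - phi x) (x - xbar).
  by rewrite /fenchel_integrand /g (grad_shift (fun x => - phi x)).
split.
  split.
  - exact: (integrable_shift xbar i1).
  - apply: (eq_integrable measurableT _ _ _ (integrable_shift xbar i2)) => x _.
    exact: (congr1 EFin (esym (entxE x))).
  - apply: (eq_integrable measurableT _ _ _ (integrable_shift xbar i3)) => x _.
    exact: (esym (fenE x)).
have massE : (\int[lebesgue_rV n]_x (expR (g x))%:E =
    \int[lebesgue_rV n]_x (expR (- phi x))%:E)%E.
  apply: (integral_shift (f := fun x => (expR (- phi x))%:E) xbar).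
  exact/measurable_EFinP.
have fenchelE : (\int[lebesgue_rV n]_x fenchel_integrand phi 1 g x =
    \int[lebesgue_rV n]_x fenchel_integrand phi 1 (fun x => - phi x)%R x)%E.
  under eq_integral do rewrite fenE.
  apply: (integral_shift (f := fenchel_integrand phi 1 (fun x => - phi x)) xbar).
  by case/integrableP: i3.
rewrite massE fenchelE.
transitivity (ent f); first exact: entE.
exact: (extremal_equality phi_C1 phi_convex phi_superlinear phi_mass1).
Qed.
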